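(* Suppose $\varphi$ is a $G_2$-structure with associated metric $g$ on a $7$-manifold $M$, with torsion $T$ and corresponding octonion covariant derivative $D$. Suppose $V$ is a unit octonion section, and $\tilde\varphi=\sigma_V(\varphi)$ is the corresponding $G_2$-structure, with torsion $\tilde T$ and octonion covariant derivative $\tilde D$. Then, for any octonion section $A$, $$\tilde D(AV^{-1})=(DA)V^{-1},$$ and equivalently $$\tilde DA=\left(D(AV)\right)V^{-1},$$ where the products written by juxtaposition are octonion products with respect to $\varphi$.
   Context: Setting. A $G_2$-structure on a smooth $7$-manifold $M$ is identified with a positive $3$-form $\varphi$, i.e. one that at each point lies in the $GL(7,\mathbb{R})$-orbit of $\varphi_0=e^{123}+e^{145}+e^{167}+e^{246}-e^{257}-e^{347}-e^{356}$. It determines a unique Riemannian metric $g$ and volume form $\mathrm{vol}$ (hence an orientation) by $g(u,v)\,\mathrm{vol}=\frac16(u\lrcorner\varphi)\wedge(v\lrcorner\varphi)\wedge\varphi$, where $\lrcorner$ is contraction. Let $*$ be the Hodge star, $\psi=*\varphi$, and $\nabla$ the Levi-Civita connection of $g$. Octonion bundle. $\mathbb{O}M=\Lambda^0\oplus TM$, where $\Lambda^0$ is the trivial real line bundle; an octonion section is $A=(a,\alpha)$ with $a$ a function and $\alpha$ a vector field. $\bar A=(a,-\alpha)$; $\langle (a,\alpha),(b,\beta)\rangle=ab+g(\alpha,\beta)$; cross product with respect to $\varphi$: $\langle\alpha\times_\varphi\beta,\gamma\rangle=\varphi(\alpha,\beta,\gamma)$; octonion product with respect to $\varphi$: $A\circ_\varphi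 B=(ab-\langle\alpha,\beta\rangle,\ a\beta+b\alpha+\alpha\times_\varphi\beta)$; $V^{-1}=\bar V/|V|^2$. Torsion and $D$. The torsion tensor $T_{ab}$ of a $G_2$-structure $\varphi$ is the $2$-tensor with $\nabla_a\varphi_{bcd}=2T_a{}^{e}\psi_{ebcd}$; it is viewed as the $\mathrm{Im}\,\mathbb{O}M$-valued $1$-form $X\mapsto T_X=(0,X\lrcorner T)$, with vector part $X^aT_a{}^b$. $\nabla_X(a,\alpha)=(\nabla_Xa,\nabla_X\alpha)$, and the octonion covariant derivative with respect to $\varphi$ is $D_XA=\nabla_XA-A\circ_\varphi T_X$. For $\tilde\varphi$, $\tilde T$ is defined by the same formula from $\tilde\varphi$ and $*\tilde\varphi$, and $\tilde D_XA=\nabla_XA-A\circ_{\tilde\varphi}\tilde T_X$. For a nowhere-vanishing octonion section $A=(a,\alpha)$, $\sigma_A(\varphi)=\frac{1}{|A|^2}\left((a^2-|\alpha|^2)\varphi-2a\,\alpha\lrcorner( *\varphi)+2\alpha\wedge(\alpha\lrcorner\varphi)\right)$ (with $\alpha$ in the wedge product being the dual $1$-form); it is known that this is a $G_2$-structure with the same metric and orientation as $\varphi$. *)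

(* Defs.v *)
From HB Require Import structures.
From mathcomp Require Import all_boot all_order all_algebra all_fingroup.
From mathcomp Require Import all_classical all_reals.
From mathcomp Require Import topology normedtype derive.
From mathcomp Require Import ring.

Set Implicit Arguments.
Unset Strict Implicit.
Unset Printing Implicit Defensive.

Import Order.TTheory GRing.Theory Num.Theory.
Import numFieldNormedType.Exports.

Local Open Scope classical_set_scope.
Local Open Scope ring_scope.

Fixpoint Ck (R : realType) (n k : nat) (U : set 'rV[R]_n)
    (f : 'rV[R]_n -> R) : Prop :=
  if k is k'.+1 then
    (forall x, U x -> differentiable f x) /\
    (forall a : 'I_n, Ck k' U (fun x => 'D_(delta_mx 0 a) f x))
  else forall x, U x -> {for x, continuous f}.

Definition smooth_on (R : realType) (n : nat) (U : set 'rV[R]_n)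
    (f : 'rV[R]_n -> R) : Prop :=
  forall k, Ck k U f.

(** A smooth manifold is given by a smooth atlas: [param i] is the inverse of
    the chart [coord i], both being unconstrained off [dom i] and its image. *)
Record manifold (R : realType) (n : nat) := Manifold {
  point :> topologicalType;
  point_hausdorff : hausdorff_space point;
  point_second_countable : @second_countable point;
  chart : Type;
  dom : chart -> set point;
  coord : chart -> point -> 'rV[R]_n;
  param : chart -> 'rV[R]_n -> point;
  dom_open : forall i, open (dom i);
  dom_cover : forall p, exists i, dom i p;
  coord_open : forall i, open (coord i @` dom i);
  coordK : forall i p, dom i p -> param i (coord i p) = p;
  coord_continuous : forall i p, dom i p -> {for p, continuous (coord i)};
  param_continuous :
    forall i p, dom i p -> {for coord i p, continuous (param i)};
  transition_smooth : forall i j (b : 'I_n),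
    smooth_on (coord i @` (dom i `&` dom j))
      (fun x => coord j (param i x) 0 b)
}.

(** The components at a point of a covariant tensor of rank [k] in a given
    frame are indexed by [k.-tuple 'I_n]; tangent vectors are row vectors of
    components.  A field on [M] assigns to each chart [i] and each point of
    [dom i] (the value at other points is irrelevant) the components with
    respect to the coordinate frame of [i]. *)

Definition tensor (R : realType) (n k : nat) := k.-tuple 'I_n -> R.

Definition field (R : realType) (n : nat) (M : manifold R n) (E : Type) :=
  chart M -> M -> E.

(** The partial derivative of [f] along the [a]-th coordinate of chart [i]. *)
Definition pd (R : realType) (n : nat) (M : manifold R n) (i : chart M)
    (a : 'I_n) (f : M -> R) (p : M) : R :=
  'D_(delta_mx 0 a) (f \o param i) (coord i p).

(** [jac i j p a b] is the derivative of the [b]-th coordinate of chart [j]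
    along the [a]-th coordinate of chart [i]. *)
Definition jac (R : realType) (n : nat) (M : manifold R n) (i j : chart M)
    (p : M) (a b : 'I_n) : R :=
  pd i a (fun q => coord j q 0 b) p.

Definition smooth_in (R : realType) (n : nat) (M : manifold R n)
    (i : chart M) (f : M -> R) : Prop :=
  smooth_on (coord i @` dom i) (f \o param i).

Definition vector_field (R : realType) (n : nat) (M : manifold R n)
    (alpha : field M 'rV[R]_n) : Prop :=
  (forall i b, smooth_in i (fun p => alpha i p 0 b)) /\
  (forall i j p, dom i p -> dom j p -> forall b,
    alpha j p 0 b = \sum_a alpha i p 0 a * jac i j p a b).

(** The pullback of [w] by the linear map sending the [a]-th basis vector to
    the [a]-th row of [P]. *)
Definition pullback (R : realType) (n k : nat) (P : 'I_n -> 'I_n -> R)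
    (w : tensor R n k) : tensor R n k :=
  fun I => \sum_(J : k.-tuple 'I_n)
             (\prod_(r < k) P (tnth I r) (tnth J r)) * w J.

Definition tensor_field (R : realType) (n k : nat) (M : manifold R n)
    (w : field M (tensor R n k)) : Prop :=
  (forall i I, smooth_in i (fun p => w i p I)) /\
  (forall i j p, dom i p -> dom j p ->
    w i p =1 pullback (jac i j p) (w j p)).

Definition alternating (R : realType) (n k : nat) (w : tensor R n k) : Prop :=
  forall (s : 'S_k) (I : k.-tuple 'I_n),
    w [tuple tnth I (s r) | r < k] = (-1) ^+ s * w I.

Definition diff_form (R : realType) (n k : nat) (M : manifold R n)
    (w : field M (tensor R n k)) : Prop :=
  tensor_field w /\ (forall i p, dom i p -> alternating (w i p)).

(** [contract X w] is the contraction of [X] into the first slot of [w]. *)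
Definition contract (R : realType) (n k : nat) (X : 'rV[R]_n)
    (w : tensor R n k.+1) : tensor R n k :=
  fun I => \sum_e X 0 e * w [tuple of e :: I].

Definition wedge (R : realType) (n k l : nat)
    (u : tensor R n k) (v : tensor R n l) : tensor R n (k + l) :=
  fun I => (k`! * l`!)%:R^-1 *
    \sum_(s : 'S_(k + l)) (-1) ^+ s *
      (u [tuple tnth I (s (lshift l r)) | r < k] *
       v [tuple tnth I (s (rshift k r)) | r < l]).

Definition inner (R : realType) (n : nat) (g : tensor R n 2)
    (X Y : 'rV[R]_n) : R :=
  \sum_a \sum_b X 0 a * Y 0 b * g [tuple a; b].

Definition metric_mx (R : realType) (n : nat) (g : tensor R n 2) : 'M[R]_n :=
  \matrix_(a, b) g [tuple a; b].

Definition metric_inv (R : realType) (n : nat) (g : tensor R n 2)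
    (a b : 'I_n) : R :=
  invmx (metric_mx g) a b.

Definition flat (R : realType) (n : nat) (g : tensor R n 2) (X : 'rV[R]_n) :
    tensor R n 1 :=
  fun I => \sum_a X 0 a * g [tuple a; tnth I ord0].

(** The vector [X] with [inner g X Y = w Y] for all [Y]. *)
Definition sharp (R : realType) (n : nat) (g : tensor R n 2)
    (w : tensor R n 1) : 'rV[R]_n :=
  \row_b \sum_a w [tuple a] * metric_inv g a b.

(** [hodge g vol w] has components
    [(1/k!) w^{a_1...a_k} vol_{a_1...a_k b_1...b_l}], with the indices of [w]
    raised by [g]. *)
Definition hodge (R : realType) (n k l : nat) (g : tensor R n 2)
    (vol : tensor R n (k + l)) (w : tensor R n k) : tensor R n l :=
  fun J => k`!%:R^-1 *
    \sum_(I : k.-tuple 'I_n) pullback (metric_inv g) w I * vol [tuple of I ++ J].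

Definition riemannian_metric (R : realType) (n : nat) (M : manifold R n)
    (g : field M (tensor R n 2)) : Prop :=
  [/\ tensor_field g,
      forall i p, dom i p -> forall a b, g i p [tuple a; b] = g i p [tuple b; a]
    & forall i p, dom i p -> forall X, X != 0 -> 0 < inner (g i p) X X].

(** [christoffel g i p c a b] is the Christoffel symbol with upper index [c]
    and lower indices [a], [b]. *)
Definition christoffel (R : realType) (n : nat) (M : manifold R n)
    (g : field M (tensor R n 2)) (i : chart M) (p : M) (c a b : 'I_n) : R :=
  2^-1 * \sum_d metric_inv (g i p) c d *
    (pd i a (fun q => g i q [tuple b; d]) p +
     pd i b (fun q => g i q [tuple a; d]) p -
     pd i d (fun q => g i q [tuple a; b]) p).

Lemma pd_metric_sym (R : realType) (n : nat) (M : manifold R n)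
    (g : field M (tensor R n 2)) (i : chart M) (p : M) (a b c : 'I_n) :
  riemannian_metric g -> dom i p ->
  pd i a (fun q => g i q [tuple b; c]) p = pd i a (fun q => g i q [tuple c; b]) p.
Proof.
move=> [_ gsym _] ip; apply: near_eq_derive.
have Hn : nbhs (coord i p) (param i @^-1` dom i).
  apply: (param_continuous ip); rewrite coordK //.
  exact: open_nbhs_nbhs (conj (@dom_open _ _ _ i) ip).
by apply: filterS Hn => x /= Hx; rewrite gsym.
Qed.

Lemma metric_mx_unit (R : realType) (n : nat) (M : manifold R n)
    (g : field M (tensor R n 2)) (i : chart M) (p : M) :
  riemannian_metric g -> dom i p -> metric_mx (g i p) \in unitmx.
Proof.
move=> [_ _ gpos] ip; rewrite -row_free_unit; apply/row_freeP.
have : kermx (metric_mx (g i p)) = 0.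
  apply/row_matrixP => r; rewrite row0.
  have : row r (kermx (metric_mx (g i p))) *m metric_mx (g i p) = 0.
    by apply/sub_kermxP/row_sub.
  move: (row r _) => X XG; apply/eqP/negPn/negP => X0.
  have := gpos _ _ ip _ X0; suff -> : inner (g i p) X X = 0 by rewrite ltxx.
  rewrite /inner exchange_big /=; apply: big1 => b _.
  transitivity (X 0 b * (X *m metric_mx (g i p)) 0 b).
    by rewrite mxE mulr_sumr; apply: eq_bigr => a _; rewrite !mxE; ring.
  by rewrite XG mxE mulr0.
move=> k0; apply/row_freeP; rewrite -kermx_eq0; exact/eqP.
Qed.

(** [christoffel g] is the Levi-Civita connection: it is the only one that is
    torsion-free and metric. *)
Lemma christoffelP (R : realType) (n : nat) (M : manifold R n)
    (g : field M (tensor R n 2)) (i : chart M) (p : M)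
    (Gamma : 'I_n -> 'I_n -> 'I_n -> R) :
  riemannian_metric g -> dom i p ->
  ((forall c a b, Gamma c a b = Gamma c b a) /\
   (forall a b c, pd i a (fun q => g i q [tuple b; c]) p =
      \sum_m Gamma m a b * g i p [tuple m; c] +
      \sum_m Gamma m a c * g i p [tuple b; m])) <->
  (forall c a b, Gamma c a b = christoffel g i p c a b).
Proof.
move=> gR ip; have gU := metric_mx_unit gR ip.
have gsym : forall a b, g i p [tuple a; b] = g i p [tuple b; a].
  by case: gR => _ + _ => /(_ _ _ ip).
have raise (f : 'I_n -> R) d :
    \sum_m (\sum_e metric_inv (g i p) m e * f e) * g i p [tuple m; d] = f d.
  transitivity ((\row_e f e *m (invmx (metric_mx (g i p)))^T
                  *m metric_mx (g i p)) 0 d).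
    rewrite mxE; apply: eq_bigr => m _; rewrite !mxE; congr (_ * _).
    by apply: eq_bigr => e _; rewrite !mxE mulrC.
  have gT : (metric_mx (g i p))^T = metric_mx (g i p).
    by apply/matrixP => a b; rewrite !mxE gsym.
  by rewrite trmx_inv gT mulmxKV // mxE.
have lower (f : 'I_n -> R) c :
    \sum_d metric_inv (g i p) c d * (\sum_m f m * g i p [tuple m; d]) = f c.
  transitivity ((invmx (metric_mx (g i p)) *m
                 (metric_mx (g i p) *m \col_m f m)) c 0).
    rewrite mxE; apply: eq_bigr => d _; rewrite mxE; congr (_ * _).
    by apply: eq_bigr => m _; rewrite !mxE gsym mulrC.
  by rewrite mulKmx // mxE.
split=> [[Gs Gm] c a b|GE].
- rewrite /christoffel -[LHS](lower (fun m => Gamma m a b)) mulr_sumr.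
  apply: eq_bigr => d _; rewrite mulrCA; congr (_ * _); rewrite !Gm.
  have E x y z : \sum_m Gamma m x y * g i p [tuple z; m] =
      \sum_m Gamma m x y * g i p [tuple m; z].
    by apply: eq_bigr => m _; rewrite gsym.
  have S x y z : \sum_m Gamma m x y * g i p [tuple m; z] =
      \sum_m Gamma m y x * g i p [tuple m; z].
    by apply: eq_bigr => m _; rewrite Gs.
  by rewrite !E (S b a) (S d a) (S d b); field.
- have F a b d : \sum_m Gamma m a b * g i p [tuple m; d] =
      2^-1 * (pd i a (fun q => g i q [tuple b; d]) p +
              pd i b (fun q => g i q [tuple a; d]) p -
              pd i d (fun q => g i q [tuple a; b]) p).
    rewrite -[RHS](raise (fun d => 2^-1 * (pd i a (fun q => g i q [tuple b; d]) p +
              pd i b (fun q => g i q [tuple a; d]) p -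
              pd i d (fun q => g i q [tuple a; b]) p)) d).
    apply: eq_bigr => m _; rewrite GE /christoffel mulr_sumr; congr (_ * _).
    by apply: eq_bigr => e _; rewrite mulrCA.
  split=> [c a b|a b c].
  + rewrite !GE /christoffel; congr (_ * _); apply: eq_bigr => d _.
    by rewrite (pd_metric_sym d a b gR ip); congr (_ * _); ring.
  + under [X in _ = _ + X]eq_bigr do rewrite gsym.
    by rewrite !F (pd_metric_sym a c b gR ip); field.
Qed.

Definition set_index (n k : nat) (I : k.-tuple 'I_n) (r : 'I_k) (m : 'I_n) :
    k.-tuple 'I_n :=
  [tuple if s == r then m else tnth I s | s < k].

(** [nabla_tensor g w i p a I] is [(nabla_a w)_I]. *)
Definition nabla_tensor (R : realType) (n k : nat) (M : manifold R n)
    (g : field M (tensor R n 2)) (w : field M (tensor R n k))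
    (i : chart M) (p : M) (a : 'I_n) : tensor R n k :=
  fun I => pd i a (fun q => w i q I) p -
    \sum_(r < k) \sum_m
      christoffel g i p m a (tnth I r) * w i p (set_index I r m).

Definition nabla_vector (R : realType) (n : nat) (M : manifold R n)
    (g : field M (tensor R n 2)) (alpha : field M 'rV[R]_n)
    (i : chart M) (p : M) (X : 'rV[R]_n) : 'rV[R]_n :=
  \row_b \sum_a X 0 a *
    (pd i a (fun q => alpha i q 0 b) p +
     \sum_c christoffel g i p b a c * alpha i p 0 c).

(** [dx J] is the wedge product of the basis covectors with indices in [J],
    which are counted from 1. *)
Definition dx (R : realType) (n k : nat) (J : k.-tuple nat) : tensor R n k :=
  fun I => \det (\matrix_(r < k, s < k)
                   ((tnth I r).+1 == tnth J s)%:R : 'M[R]_k).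

Definition phi0 (R : realType) : tensor R 7 3 := fun I =>
  dx R [tuple 1; 2; 3]%N I + dx R [tuple 1; 4; 5]%N I
  + dx R [tuple 1; 6; 7]%N I + dx R [tuple 2; 4; 6]%N I
  - dx R [tuple 2; 5; 7]%N I - dx R [tuple 3; 4; 7]%N I
  - dx R [tuple 3; 5; 6]%N I.

Definition positive (R : realType) (w : tensor R 7 3) : Prop :=
  exists2 P : 'M[R]_7, P \in unitmx & w =1 pullback P (@phi0 R).

(** The Riemannian volume form of [g] for one of the orientations: in
    coordinates, [sqrt (det g) dx^1 /\ ... /\ dx^n] up to sign. *)
Definition volume_form (R : realType) (n : nat) (M : manifold R n)
    (g : field M (tensor R n 2)) (vol : field M (tensor R n n)) : Prop :=
  diff_form vol /\
  (forall i p, dom i p -> vol i p (ord_tuple n) ^+ 2 = \det (metric_mx (g i p))).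

(** A [G_2]-structure together with the metric and volume form it determines.
    Requiring [volume] to be the volume form of [metric] makes the pair unique:
    the equation [metric_volume] alone leaves a rescaling free. *)
Record G2_structure (R : realType) (M : manifold R 7) := G2Structure {
  G2_form : field M (tensor R 7 3);
  metric : field M (tensor R 7 2);
  volume : field M (tensor R 7 7);
  G2_form_diff_form : diff_form G2_form;
  G2_form_positive : forall i p, dom i p -> positive (G2_form i p);
  metric_riemannian : riemannian_metric metric;
  volume_volume_form : volume_form metric volume;
  metric_volume : forall i p, dom i p -> forall u v I,
    inner (metric i p) u v * volume i p I =
    6^-1 * wedge (wedge (contract u (G2_form i p)) (contract v (G2_form i p)))
                 (G2_form i p) I
}.

Definition dual_form (R : realType) (M : manifold R 7) (S : G2_structure M) :
    field M (tensor R 7 4) :=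
  fun i p => @hodge R 7 3 4 (metric S i p) (volume S i p) (G2_form S i p).

Definition octonion (R : realType) := (R * 'rV[R]_7)%type.

Definition octonion_section (R : realType) (M : manifold R 7)
    (A : field M (octonion R)) : Prop :=
  [/\ forall i, smooth_in i (fun p => (A i p).1),
      forall i j p, dom i p -> dom j p -> (A i p).1 = (A j p).1
    & vector_field (fun i p => (A i p).2)].

Definition oct_inner (R : realType) (g : tensor R 7 2) (A B : octonion R) : R :=
  A.1 * B.1 + inner g A.2 B.2.

Definition oct_conj (R : realType) (A : octonion R) : octonion R :=
  (A.1, - A.2).

Definition oct_inv (R : realType) (g : tensor R 7 2) (A : octonion R) :
    octonion R :=
  ((oct_inner g A A)^-1 * (oct_conj A).1, (oct_inner g A A)^-1 *: (oct_conj A).2).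

Definition cross (R : realType) (g : tensor R 7 2) (phi : tensor R 7 3)
    (X Y : 'rV[R]_7) : 'rV[R]_7 :=
  sharp g (contract Y (contract X phi)).

Definition oct_mul (R : realType) (g : tensor R 7 2) (phi : tensor R 7 3)
    (A B : octonion R) : octonion R :=
  (A.1 * B.1 - inner g A.2 B.2,
   A.1 *: B.2 + B.1 *: A.2 + cross g phi A.2 B.2).

Definition mul_section (R : realType) (M : manifold R 7) (S : G2_structure M)
    (A B : field M (octonion R)) : field M (octonion R) :=
  fun i p => oct_mul (metric S i p) (G2_form S i p) (A i p) (B i p).

Definition inv_section (R : realType) (M : manifold R 7) (S : G2_structure M)
    (A : field M (octonion R)) : field M (octonion R) :=
  fun i p => oct_inv (metric S i p) (A i p).

Definition unit_section (R : realType) (M : manifold R 7) (S : G2_structure M)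
    (V : field M (octonion R)) : Prop :=
  octonion_section V /\
  (forall i p, dom i p -> oct_inner (metric S i p) (V i p) (V i p) = 1).

(** [sigma S A] is the 3-form [sigma_A(phi)], [phi] being the form of [S]. *)
Definition sigma (R : realType) (M : manifold R 7) (S : G2_structure M)
    (A : field M (octonion R)) : field M (tensor R 7 3) :=
  fun i p =>
    let g := metric S i p in
    let phi := G2_form S i p in
    let a := (A i p).1 in
    let alpha := (A i p).2 in
    fun I => (oct_inner g (A i p) (A i p))^-1 *
      ((a ^+ 2 - inner g alpha alpha) * phi I
       - 2 * a * contract alpha (dual_form S i p) I
       + 2 * wedge (flat g alpha) (contract alpha phi) I).

(** [T_a^e] is the component of index [e] of [torsion_vector]. *)
Definition torsion_vector (R : realType) (g : tensor R 7 2) (T : tensor R 7 2)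
    (X : 'rV[R]_7) : 'rV[R]_7 :=
  sharp g (contract X T).

Definition is_torsion (R : realType) (M : manifold R 7) (S : G2_structure M)
    (T : field M (tensor R 7 2)) : Prop :=
  tensor_field T /\
  (forall i p, dom i p -> forall a b c d,
    nabla_tensor (metric S) (G2_form S) i p a [tuple b; c; d] =
    2 * \sum_e torsion_vector (metric S i p) (T i p) (delta_mx 0 a) 0 e
               * dual_form S i p [tuple e; b; c; d]).

Definition nabla_octonion (R : realType) (M : manifold R 7)
    (g : field M (tensor R 7 2)) (A : field M (octonion R))
    (i : chart M) (p : M) (X : 'rV[R]_7) : octonion R :=
  (\sum_a X 0 a * pd i a (fun q => (A i q).1) p,
   nabla_vector g (fun j q => (A j q).2) i p X).

(** [oct_D S T A i p X] is [D_X A] at [p], for [X] a tangent vector at [p]. *)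
Definition oct_D (R : realType) (M : manifold R 7) (S : G2_structure M)
    (T : field M (tensor R 7 2)) (A : field M (octonion R))
    (i : chart M) (p : M) (X : 'rV[R]_7) : octonion R :=
  nabla_octonion (metric S) A i p X
  - oct_mul (metric S i p) (G2_form S i p) (A i p)
      (0, torsion_vector (metric S i p) (T i p) X).

(* Main.v *)
(** In a frame in which [phi] is [phi0], the product [oct_mul] is that of the standard
    octonions, so algebraic identities are polynomial identities in eight coordinates.
    Write [[A,B,C] = (AB)C - A(BC)].  As [[a,b,c] = 2 psi(a,b,c,.)] on imaginary
    octonions, the torsion equation [nabla phi = 2 T psi] says
    [nabla (AB) = (nabla A)B + A(nabla B) + [T,A,B]], i.e. [D(AB) = (nabla A)B + A(DB)].

    The product of [sigma_V(phi)] is [A o B = (A(BV))V^-1].  It is again a composition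
    product for [g], which forces the metric of [sigma_V(phi)] to be [g].  Applying [D]
    to [(A o B)V = A(BV)] gives the Leibniz rule for [o] with [-(DV)V^-1] in the place of
    the torsion; the associator being nondegenerate, this is the torsion of
    [sigma_V(phi)].  Hence its [D~] satisfies
    [D~A = nabla A + A o ((DV)V^-1) = (nabla A) + (A(DV))V^-1 = (D(AV))V^-1]. *)

Require Import Defs.
From mathcomp Require Import all_boot all_order all_algebra.
From mathcomp Require Import fingroup perm.
From mathcomp Require Import all_classical all_reals.
From mathcomp Require Import topology normedtype derive.
From mathcomp Require Import ring lra.
Import Defs.

Set Implicit Arguments.
Unset Strict Implicit.
Unset Printing Implicit Defensive.

Import Order.TTheory GRing.Theory Num.Theory.
Import numFieldNormedType.Exports.

Local Open Scope classical_set_scope.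
Local Open Scope ring_scope.

(** * Standard octonions *)

(** The metric of [phit] is tied to its form only by an identity cubic in the form, and [Tt] only by
    the torsion equation, so both have to be shown to be determined. For the metric, let [W] be the
    2-form got by contracting [x] into the 3-form; no metric occurs in it. For every [G] whose
    product is a composition product, [det (W + f f^T)^2 = |x|^16 (det G)^2] with [f = G x] and
    [|x|] taken in [G]. Two such metrics are therefore proportional, and comparing determinants
    makes the factor 1; the triple wedge of [sigma_V(phi)] is never expanded. For the torsion,
    nondegeneracy of the associator sees only imaginary octonions, so [(DV)V^-1] must separately be
    shown imaginary: this is where [|V| = 1] is differentiated. Derivatives are total functions,
    meaningless where the limit fails to exist, so every Leibniz rule carries existence along. The
    cross product contains the inverse metric; its derivative is found after lowering the index,
    where only [phi] and [g] are differentiated. *)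

Record oct8 (R : Type) := Oct8 {
  o0 : R; o1 : R; o2 : R; o3 : R; o4 : R; o5 : R; o6 : R; o7 : R }.

Section StandardOctonions.
Variable R : comPzRingType.
Implicit Types x y z t v : oct8 R.

(** The signs come from [phi0]: a term [e^{abc}] gives the cyclic rules [e_a e_b = e_c], with
    opposite sign for 257, 347 and 356. Hence [phi0(x,y,z) = <xy,z>] on imaginary octonions. *)
Definition mul8 x y : oct8 R :=
  let: Oct8 a x1 x2 x3 x4 x5 x6 x7 := x in
  let: Oct8 b y1 y2 y3 y4 y5 y6 y7 := y in
  Oct8
    (a * b - (x1 * y1 + x2 * y2 + x3 * y3 + x4 * y4 + x5 * y5 + x6 * y6 + x7 * y7))
    (a * y1 + b * x1 + (x2 * y3 - x3 * y2 + (x4 * y5 - x5 * y4) + (x6 * y7 - x7 * y6)))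
    (a * y2 + b * x2 + (x3 * y1 - x1 * y3 + (x4 * y6 - x6 * y4) - (x5 * y7 - x7 * y5)))
    (a * y3 + b * x3 + (x1 * y2 - x2 * y1 - (x4 * y7 - x7 * y4) - (x5 * y6 - x6 * y5)))
    (a * y4 + b * x4 + (x5 * y1 - x1 * y5 + (x6 * y2 - x2 * y6) - (x7 * y3 - x3 * y7)))
    (a * y5 + b * x5 + (x1 * y4 - x4 * y1 - (x7 * y2 - x2 * y7) - (x6 * y3 - x3 * y6)))
    (a * y6 + b * x6 + (x7 * y1 - x1 * y7 + (x2 * y4 - x4 * y2) - (x3 * y5 - x5 * y3)))
    (a * y7 + b * x7 + (x1 * y6 - x6 * y1 - (x2 * y5 - x5 * y2) - (x3 * y4 - x4 * y3))).

Definition add8 x y : oct8 R :=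
  let: Oct8 a x1 x2 x3 x4 x5 x6 x7 := x in
  let: Oct8 b y1 y2 y3 y4 y5 y6 y7 := y in
  Oct8 (a + b) (x1 + y1) (x2 + y2) (x3 + y3) (x4 + y4) (x5 + y5) (x6 + y6) (x7 + y7).

Definition scale8 k x : oct8 R :=
  let: Oct8 a x1 x2 x3 x4 x5 x6 x7 := x in
  Oct8 (k * a) (k * x1) (k * x2) (k * x3) (k * x4) (k * x5) (k * x6) (k * x7).

Definition opp8 x : oct8 R :=
  let: Oct8 a x1 x2 x3 x4 x5 x6 x7 := x in
  Oct8 (- a) (- x1) (- x2) (- x3) (- x4) (- x5) (- x6) (- x7).

Definition dot8 x y : R :=
  let: Oct8 a x1 x2 x3 x4 x5 x6 x7 := x in
  let: Oct8 b y1 y2 y3 y4 y5 y6 y7 := y in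
  a * b + (x1 * y1 + x2 * y2 + x3 * y3 + x4 * y4 + x5 * y5 + x6 * y6 + x7 * y7).

Definition conj8 x : oct8 R :=
  let: Oct8 a x1 x2 x3 x4 x5 x6 x7 := x in
  Oct8 a (- x1) (- x2) (- x3) (- x4) (- x5) (- x6) (- x7).

Definition im8 x : oct8 R :=
  let: Oct8 a x1 x2 x3 x4 x5 x6 x7 := x in Oct8 0 x1 x2 x3 x4 x5 x6 x7.

Definition assoc8 x y z : oct8 R :=
  add8 (mul8 (mul8 x y) z) (opp8 (mul8 x (mul8 y z))).

Local Ltac components :=
  repeat (let x := fresh in intro x; case: x => ????????); rewrite /assoc8 /=;
  solve [ring | congr Oct8; ring].

Lemma add8N x : add8 x (opp8 x) = Oct8 0 0 0 0 0 0 0 0.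
Proof. move: x; components. Qed.

Lemma mul8Dl x y z : mul8 (add8 x y) z = add8 (mul8 x z) (mul8 y z).
Proof. move: x y z; components. Qed.

Lemma mul8Dr x y z : mul8 x (add8 y z) = add8 (mul8 x y) (mul8 x z).
Proof. move: x y z; components. Qed.

Lemma mul8Nl x y : mul8 (opp8 x) y = opp8 (mul8 x y).
Proof. move: x y; components. Qed.

Lemma mul8Nr x y : mul8 x (opp8 y) = opp8 (mul8 x y).
Proof. move: x y; components. Qed.

Lemma mul8Zl k x y : mul8 (scale8 k x) y = scale8 k (mul8 x y).
Proof. move: x y; components. Qed.

Lemma mul8_conjr x y : mul8 (mul8 x y) (conj8 y) = scale8 (dot8 y y) x.
Proof. move: x y; components. Qed.

Lemma mul8_conjl x y : mul8 (conj8 x) (mul8 x y) = scale8 (dot8 x x) y.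
Proof. move: x y; components. Qed.

(** Octonions are alternative, so the associator is alternating. Cyclic invariance carries the
    torsion from the first slot, where the derivative of [phi] puts it, to the last, where [D]
    subtracts it. *)
Lemma assoc8C x y z : assoc8 x y z = assoc8 y z x.
Proof. move: x y z; components. Qed.

Lemma re_assoc8 x y z : o0 (assoc8 x y z) = 0.
Proof. move: x y z; components. Qed.

Lemma re_mul8_conj x y : o0 (mul8 x (conj8 y)) = dot8 x y.
Proof. move: x y; components. Qed.

Lemma assoc8_im x y z : assoc8 x y z = assoc8 x (im8 y) (im8 z).
Proof. move: x y z; components. Qed.

Lemma assoc8Br x y z t :
  assoc8 x y (add8 z (opp8 t)) = add8 (assoc8 x y z) (opp8 (assoc8 x y t)).
Proof. move: x y z t; components. Qed.

Lemma dot8_mulr x y : dot8 (mul8 x y) x = dot8 x x * o0 y.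
Proof. move: x y; components. Qed.

Lemma mul1_8 x : mul8 (Oct8 1 0 0 0 0 0 0 0) x = x.
Proof. move: x; components. Qed.

Lemma dot8C x y : dot8 x y = dot8 y x.
Proof. move: x y; components. Qed.

(** For [|v| = 1] the right side is the product of [sigma_v(phi0)] paired with [z]: the scalar
    terms, then [phi0], then [2 psi] contracted with [v] and written as an associator, then the six
    permutations of the wedge of [v] with its contraction into [phi0]. The factor [|v|^2] in front
    keeps the identity polynomial. *)
Lemma dot8_twisted_mul v x y z :
  dot8 (mul8 (mul8 x (mul8 y v)) (conj8 v)) z =
  dot8 v v * ((o0 x * o0 y - dot8 (im8 x) (im8 y)) * o0 z +
    o0 x * dot8 (im8 y) (im8 z) + o0 y * dot8 (im8 x) (im8 z)) +
  ((o0 v ^+ 2 - dot8 (im8 v) (im8 v)) * dot8 (mul8 (im8 x) (im8 y)) (im8 z)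
   - o0 v * dot8 (assoc8 (im8 v) (im8 x) (im8 y)) (im8 z)
   + (dot8 (im8 v) (im8 x) * dot8 (mul8 (im8 v) (im8 y)) (im8 z)
      - dot8 (im8 v) (im8 x) * dot8 (mul8 (im8 v) (im8 z)) (im8 y)
      + dot8 (im8 v) (im8 y) * dot8 (mul8 (im8 v) (im8 z)) (im8 x)
      - dot8 (im8 v) (im8 y) * dot8 (mul8 (im8 v) (im8 x)) (im8 z)
      + dot8 (im8 v) (im8 z) * dot8 (mul8 (im8 v) (im8 x)) (im8 y)
      - dot8 (im8 v) (im8 z) * dot8 (mul8 (im8 v) (im8 y)) (im8 x))).
Proof. move: v x y z; components. Qed.

End StandardOctonions.

(** * Tensors in a frame *)

Section TupleSums.
Variables (V : nmodType) (n : nat).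

Lemma sum_tuple0 (F : 0.-tuple 'I_n -> V) : \sum_J F J = F [tuple].
Proof. by rewrite (big_pred1 [tuple]) // => J; rewrite (tuple0 J) /= eqxx. Qed.

Lemma sum_tuple_cons k (F : k.+1.-tuple 'I_n -> V) :
  \sum_J F J = \sum_a \sum_(J : k.-tuple 'I_n) F [tuple of a :: J].
Proof.
rewrite pair_bigA /=.
rewrite (reindex (fun p : 'I_n * k.-tuple 'I_n => [tuple of p.1 :: p.2])) //=.
exists (fun J : k.+1.-tuple 'I_n => (thead J, [tuple of behead J])) => [[a J] _|J _].
  by congr pair; apply/val_inj.
by rewrite [RHS]tuple_eta; apply/val_inj.
Qed.

Lemma sum_tuple_cat k l (F : (k + l).-tuple 'I_n -> V) :
  \sum_J F J = \sum_(A : k.-tuple 'I_n) \sum_(B : l.-tuple 'I_n) F [tuple of A ++ B].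
Proof.
elim: k F => [|k IH] F.
  rewrite sum_tuple0; apply: eq_bigr => B _; congr F; exact/val_inj.
rewrite (@sum_tuple_cons (k + l)) sum_tuple_cons; apply: eq_bigr => a _.
rewrite IH; apply: eq_bigr => A _; apply: eq_bigr => B _; congr F; exact/val_inj.
Qed.

End TupleSums.

Lemma sum_tuple_prod (R : comPzRingType) n k (F : 'I_k -> 'I_n -> R) :
  \sum_(J : k.-tuple 'I_n) \prod_(r < k) F r (tnth J r) = \prod_(r < k) \sum_b F r b.
Proof.
rewrite bigA_distr_bigA (reindex (fun f : {ffun 'I_k -> 'I_n} => [tuple f r | r < k])) /=.
  by apply: eq_bigr => f _; apply: eq_bigr => r _; rewrite tnth_mktuple.
exists (fun J : k.-tuple 'I_n => [ffun r => tnth J r]) => [f _|J _].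
  by apply/ffunP => r; rewrite ffunE tnth_mktuple.
by apply: eq_from_tnth => r; rewrite tnth_mktuple ffunE.
Qed.

Lemma prod_delta (R : comPzRingType) n k (I J : k.-tuple 'I_n) :
  \prod_(r < k) (tnth I r == tnth J r)%:R = (I == J)%:R :> R.
Proof.
case: eqP => [->|IJ]; first by apply: big1 => r _; rewrite eqxx.
have [r /negbTE IJr] : exists r, tnth I r != tnth J r.
  apply/existsP; apply: contra_notT IJ => /existsPn IJ.
  by apply: eq_from_tnth => r; apply/eqP; rewrite -[_ == _]negbK IJ.
by rewrite (bigD1 r) //= IJr mul0r.
Qed.

Lemma lshift_tcat (T : eqType) k l (A : k.-tuple T) (B : l.-tuple T) :
  [tuple tnth [tuple of A ++ B] (lshift l r) | r < k] = A.
Proof. by apply: eq_from_tnth => r; rewrite tnth_mktuple tnth_lshift. Qed.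

Lemma rshift_tcat (T : eqType) k l (A : k.-tuple T) (B : l.-tuple T) :
  [tuple tnth [tuple of A ++ B] (rshift k r) | r < l] = B.
Proof. by apply: eq_from_tnth => r; rewrite tnth_mktuple tnth_rshift. Qed.

Section Multilinear.
Variables (R : realType) (n : nat).

Definition tprod k l (u : tensor R n k) (v : tensor R n l) : tensor R n (k + l) :=
  fun I => u [tuple tnth I (lshift l r) | r < k] * v [tuple tnth I (rshift k r) | r < l].

Definition alternate k (w : tensor R n k) : tensor R n k :=
  fun I => \sum_(s : 'S_k) (-1) ^+ s * w [tuple tnth I (s r) | r < k].

Lemma eq_alternate k (u v : tensor R n k) : u =1 v -> alternate u =1 alternate v.
Proof. by move=> uv I; apply: eq_bigr => s _; rewrite uv. Qed.

Lemma wedgeE k l (u : tensor R n k) (v : tensor R n l) I :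
  wedge u v I = (k`! * l`!)%:R^-1 * alternate (tprod u v) I.
Proof.
congr (_ * _); apply: eq_bigr => s _; congr (_ * (u _ * v _));
by apply: eq_from_tnth => r; rewrite !tnth_mktuple.
Qed.

Lemma pullbackM k (P Q : 'I_n -> 'I_n -> R) (w : tensor R n k) :
  pullback P (pullback Q w) =1 pullback (fun a c => \sum_b P a b * Q b c) w.
Proof.
move=> I; rewrite /pullback; under eq_bigr do rewrite mulr_sumr.
rewrite exchange_big; apply: eq_bigr => K _ /=; rewrite -sum_tuple_prod mulr_suml.
by apply: eq_bigr => J _; rewrite mulrA -big_split.
Qed.

Lemma eq_pullback k (P Q : 'I_n -> 'I_n -> R) (u v : tensor R n k) :
  P =2 Q -> u =1 v -> pullback P u =1 pullback Q v.
Proof.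
move=> PQ uv I; apply: eq_bigr => J _; rewrite uv; congr (_ * _).
by apply: eq_bigr => r _; rewrite PQ.
Qed.

Lemma pullback_contract k (P : 'M[R]_n) (X : 'rV[R]_n) (w : tensor R n k.+1) :
  contract X (pullback P w) =1 pullback P (contract (X *m P) w).
Proof.
move=> I; rewrite /contract /pullback.
under eq_bigr => e _ do rewrite sum_tuple_cons mulr_sumr.
transitivity (\sum_e \sum_a \sum_(J : k.-tuple 'I_n)
   X 0 e * (P e a * (\prod_(r < k) P (tnth I r) (tnth J r)) * w [tuple of a :: J])).
  apply: eq_bigr => e _; apply: eq_bigr => a _; rewrite mulr_sumr.
  apply: eq_bigr => J _; rewrite big_ord_recl.
  congr (_ * (_ * _ * _)); apply: eq_bigr => r _.
  by rewrite !(tnth_nth a) /=.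
rewrite exchange_big /=; under eq_bigr do rewrite exchange_big.
rewrite exchange_big; apply: eq_bigr => J _; rewrite mulr_sumr; apply: eq_bigr => a _.
rewrite mxE mulr_suml mulr_sumr; apply: eq_bigr => e _; ring.
Qed.

Lemma pullback_tprod k l P (u : tensor R n k) (v : tensor R n l) :
  tprod (pullback P u) (pullback P v) =1 pullback P (tprod u v).
Proof.
move=> I; rewrite /tprod /pullback sum_tuple_cat mulr_suml; apply: eq_bigr => A _.
rewrite mulr_sumr; apply: eq_bigr => B _; rewrite big_split_ord lshift_tcat rshift_tcat /=.
rewrite mulrACA; congr (_ * _ * _); apply: eq_bigr => r _;
by rewrite tnth_mktuple ?tnth_lshift ?tnth_rshift.
Qed.

(** By the Leibniz formula the alternating sum falls entirely on the entries of [P]. In top degree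
    the determinants that appear are [\det P] times the Levi-Civita symbol. *)
Lemma alternate_pullback k (P : 'I_n -> 'I_n -> R) (w : tensor R n k) I :
  alternate (pullback P w) I =
  \sum_J \det (\matrix_(r < k, s < k) P (tnth I s) (tnth J r)) * w J.
Proof.
rewrite /alternate /pullback; under eq_bigr do rewrite mulr_sumr.
rewrite exchange_big; apply: eq_bigr => J _; rewrite /= mulr_suml; apply: eq_bigr => s _.
rewrite mulrA; congr (_ * _ * _); apply: eq_bigr => r _.
by rewrite mxE tnth_mktuple.
Qed.

End Multilinear.

Section LiftPerm.
Variables k l : nat.

Definition lperm_fun (t : 'S_k) (i : 'I_(k + l)) : 'I_(k + l) :=
  match fintype.split i with inl j => lshift l (t j) | inr j => rshift k j end.

Lemma lperm_inj t : injective (lperm_fun t).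
Proof.
move=> i j; rewrite /lperm_fun -[i]splitK -[j]splitK.
case: (fintype.split i) => a; case: (fintype.split j) => b; rewrite /= ?(unsplitK (inl _))
    ?(unsplitK (inr _)).
- by move/lshift_inj/perm_inj->.
- by move/eqP; rewrite eq_lrshift.
- by move/eqP; rewrite eq_rlshift.
- by move/rshift_inj->.
Qed.

Definition lperm t : 'S_(k + l) := perm (@lperm_inj t).

Lemma lperm_lshift t j : lperm t (lshift l j) = lshift l (t j).
Proof. by rewrite permE /lperm_fun (unsplitK (inl j)). Qed.

Lemma lperm_rshift t j : lperm t (rshift k j) = rshift k j.
Proof. by rewrite permE /lperm_fun (unsplitK (inr j)). Qed.

(** The permutation matrix is block diagonal with an identity block, so the sign comes out as a
    determinant. *)
Lemma sign_lperm (R : comPzRingType) t : (-1) ^+ lperm t = (-1) ^+ t :> R.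
Proof.
rewrite -!det_perm.
have -> : perm_mx (lperm t) = block_mx (perm_mx t) 0 0 1%:M :> 'M[R]_(k + l).
  apply/matrixP => i j; rewrite mxE mxE -[i]splitK -[j]splitK.
  case: (fintype.split i) => a; case: (fintype.split j) => b /=;
  rewrite ?lperm_lshift ?lperm_rshift ?block_mxEul ?block_mxEur ?block_mxEdl ?block_mxEdr !mxE
    ?eq_lshift ?eq_rshift ?eq_lrshift ?eq_rlshift //.
by rewrite det_ublock det1 mulr1.
Qed.

End LiftPerm.

(** Antisymmetrizing first in the slots of [u] is redundant: permutations of these slots
    are absorbed by the outer sum. *)
Lemma alternate_tprod (R : realType) n k l (u : tensor R n k) (v : tensor R n l) I :
  alternate (tprod (alternate u) v) I = k`!%:R * alternate (tprod u v) I.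
Proof.
transitivity (\sum_(t : 'S_k) \sum_(s : 'S_(k + l)) (-1) ^+ s * ((-1) ^+ t *
   (u [tuple tnth I (s (lshift l (t r))) | r < k] * v [tuple tnth I (s (rshift k r)) | r <
       l]))).
  rewrite exchange_big; apply: eq_bigr => s _; rewrite /tprod /alternate mulr_suml mulr_sumr.
  apply: eq_bigr => t _; rewrite -mulrA; congr (_ * (_ * (u _ * v _)));
  by apply: eq_from_tnth => r; rewrite !tnth_mktuple.
under eq_bigr => t _.
  rewrite (reindex_inj (mulgI (lperm l t)^-1%g)) /=.
  over.
transitivity (\sum_(t : 'S_k) alternate (tprod u v) I); last first.
  rewrite sumr_const (_ : #|_| = k`!) ?mulr_natl // -card_Sn; apply: eq_card => s.
  by rewrite !inE.
apply: eq_bigr => t _; apply: eq_bigr => s _.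
rewrite odd_permM odd_permV signr_addb sign_lperm mulrACA -expr2 sqrr_sign mul1r.
congr (_ * (u _ * v _)); apply: eq_from_tnth => r; rewrite !tnth_mktuple permM.
  by rewrite -lperm_lshift permK.
by rewrite -[in LHS](@lperm_rshift k l t r) permK.
Qed.

Section LeviCivita.
Variables (R : realType) (n : nat).

(** The Levi-Civita symbol, that is, [e^1 /\ ... /\ e^n]. *)
Definition det_tensor : tensor R n n :=
  fun K => \det (\matrix_(r < n, c < n) (tnth K r == c)%:R).

Lemma alternating_top (w : tensor R n n) (K : n.-tuple 'I_n) :
  alternating w -> w K = w (ord_tuple n) * det_tensor K.
Proof.
move=> walt; have [Ki|/injectivePn[r1 [r2 r12 Kr]]] := boolP (injectiveb (tnth K)).
  pose s : 'S_n := perm (injectiveP _ Ki).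
  have -> : K = [tuple tnth (ord_tuple n) (s r) | r < n].
    by apply: eq_from_tnth => r; rewrite tnth_mktuple tnth_ord_tuple permE.
  rewrite walt mulrC; congr (_ * _); rewrite -det_perm; congr (\det _).
  by apply/matrixP => r c; rewrite !mxE tnth_mktuple tnth_ord_tuple.
rewrite /det_tensor (determinant_alternate r12) ?mulr0; last first.
  by move=> c; rewrite !mxE Kr.
have : w K = - w K.
  rewrite -[in LHS](_ : [tuple tnth K (tperm r1 r2 r) | r < n] = K).
    by rewrite walt odd_tperm r12 expr1 mulN1r.
  apply: eq_from_tnth => r; rewrite tnth_mktuple.
  by case: tpermP => [->|->|].
lra.
Qed.

Lemma pullback_det_tensor (P : 'M[R]_n) K :
  pullback P det_tensor K = \det P * det_tensor K.
Proof.
rewrite mulrC -det_mulmx.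
have -> : (\matrix_(r, c) (tnth K r == c)%:R) *m P = \matrix_(r, c) P (tnth K r) c.
  apply/matrixP => r c; rewrite !mxE (bigD1 (tnth K r)) //= mxE eqxx mul1r big1 ?addr0 //.
  by move=> b; rewrite mxE eq_sym => /negbTE->; rewrite mul0r.
rewrite /pullback /det_tensor; under eq_bigr do rewrite mulr_sumr.
rewrite exchange_big; apply: eq_bigr => s _ /=.
transitivity ((-1) ^+ s * \sum_(J : n.-tuple 'I_n) \prod_(r < n) (P (tnth K r) (tnth J r) *
    (tnth J r == s r)%:R)).
  rewrite mulr_sumr; apply: eq_bigr => J _; rewrite mulrCA big_split; congr (_ * (_ * _)).
  by apply: eq_bigr => r _; rewrite mxE.
rewrite (sum_tuple_prod (fun r b => P (tnth K r) b * (b == s r)%:R)); congr (_ * _).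
apply: eq_bigr => r _; rewrite mxE (bigD1 (s r)) //= eqxx mulr1 big1 ?addr0 //.
by move=> b /negbTE->; rewrite mulr0.
Qed.

(** Full contraction is invariant when one tensor transforms by [P] and the other by its inverse
    transpose: summing slot by slot leaves [k] copies of [Q^T P = 1]. *)
Lemma pairing_pullback k (P Q : 'M[R]_n) (u v : tensor R n k) :
  Q^T *m P = 1%:M ->
  \sum_I pullback Q u I * pullback P v I = \sum_I u I * v I.
Proof.
move=> QP; rewrite /pullback.
transitivity (\sum_L \sum_C (\sum_I \prod_(r < k) (Q (tnth I r) (tnth L r) * P (tnth I r) (tnth
    C r))) * (u L * v C)).
  transitivity (\sum_I \sum_L \sum_C
     (\prod_(r < k) (Q (tnth I r) (tnth L r) * P (tnth I r) (tnth C r))) * (u L * v C)).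
    apply: eq_bigr => I _; rewrite mulr_suml; apply: eq_bigr => L _.
    rewrite mulr_sumr; apply: eq_bigr => C _; rewrite big_split mulrACA //.
  rewrite exchange_big; apply: eq_bigr => L _ /=; rewrite exchange_big.
  by apply: eq_bigr => C _; rewrite mulr_suml.
apply: eq_bigr => L _.
have E C : \sum_(I : k.-tuple 'I_n) \prod_(r < k) (Q (tnth I r) (tnth L r) * P (tnth I r) (tnth
    C r)) = (L == C)%:R.
  rewrite (sum_tuple_prod (fun r b => Q b (tnth L r) * P b (tnth C r))) -prod_delta.
  apply: eq_bigr => r _; move/matrixP: QP => /(_ (tnth L r) (tnth C r)).
  rewrite !mxE => <-; by apply: eq_bigr => b _; rewrite mxE.
rewrite (bigD1 L) //= E eqxx mul1r big1 ?addr0 // => C; rewrite E eq_sym.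
by move/negbTE->; rewrite mul0r.
Qed.

Lemma pullback_cat k l (P : 'M[R]_n) (w : tensor R n (k + l)) (I : k.-tuple 'I_n) (J : l.-tuple
    'I_n) :
  pullback P w [tuple of I ++ J] =
  pullback P (fun C => pullback P (fun N => w [tuple of C ++ N]) J) I.
Proof.
rewrite /pullback sum_tuple_cat; apply: eq_bigr => C _; rewrite mulr_sumr.
apply: eq_bigr => N _; rewrite mulrA big_split_ord; congr (_ * _ * _);
by apply: eq_bigr => r _; rewrite ?tnth_lshift ?tnth_rshift.
Qed.

End LeviCivita.

(** Raising indices by [(P P^T)^-1] turns the pullback by [P] into the one by [(P P^T)^-1 P], the
    inverse transpose of [P]. The contraction with the volume form is then the one for the standard
    metric, pulled back. *)
Lemma hodge_pullback (R : realType) n k l (P : 'M[R]_n) (g : tensor R n 2)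
    (w : tensor R n k) (vol : tensor R n (k + l)) J :
  P \in unitmx -> metric_mx g = P *m P^T ->
  @hodge R n k l g (pullback P vol) (pullback P w) J =
  pullback P (fun N => k`!%:R^-1 * \sum_I w I * vol [tuple of I ++ N]) J.
Proof.
move=> PU gP; rewrite /hodge.
transitivity (k`!%:R^-1 * \sum_I w I * pullback P (fun N => vol [tuple of I ++ N]) J).
  congr (_ * _); rewrite -(@pairing_pullback _ _ _ P (invmx (metric_mx g) *m P)).
    apply: eq_bigr => I _; rewrite pullbackM pullback_cat; congr (_ * _).
    by apply: eq_pullback => // a b; rewrite mxE.
  rewrite gP trmx_mul trmx_inv trmx_mul trmxK; apply: (can_inj (mulKmx PU)).
  by rewrite mulmx1 !mulmxA mulmxV ?mul1mx // unitmx_mul unitmx_tr PU.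
rewrite /pullback mulr_sumr.
under eq_bigr => I _ do rewrite mulrA mulr_sumr.
rewrite exchange_big; apply: eq_bigr => N _; rewrite !mulr_sumr.
by apply: eq_bigr => I _; ring.
Qed.

(** * Metric and dual form by finite computation *)

(** Expansion along the first column, on integers indexed by [nat], so that it evaluates by
    [vm_compute]; skipping zero entries pays off because the matrices are sparse. *)
Fixpoint ldet (n : nat) (f : nat -> nat -> int) : int :=
  if n is n'.+1 then
    foldr (fun i s => let x := f i 0 in
      if x == 0 then s
      else (if odd i then - x else x) * ldet n' (fun r c => f (bump i r) c.+1) + s)
      0 (iota 0 n)
  else 1.

Lemma ldetP n (f : nat -> nat -> int) : \det (\matrix_(r < n, c < n) f r c) = ldet n f.
Proof.
elim: n f => [|n IH] f; first by rewrite det_mx00.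
rewrite (expand_det_col _ 0) [ldet _ _]/=.
rewrite -[RHS]/(foldr (fun i s => if f i 0 == 0 then s
   else (if odd i then - f i 0 else f i 0) * ldet n (fun r c => f (bump i r) c.+1) + s)
      0 (iota 0 n.+1)).
transitivity (\sum_(i <- iota 0 n.+1)
   ((if odd i then - f i 0 else f i 0) * ldet n (fun r c => f (bump i r) c.+1))).
  rewrite -[iota 0 n.+1]/(index_iota 0 n.+1) big_mkord; apply: eq_bigr => i _.
  rewrite mxE /cofactor -IH addn0 -signr_odd mulrA.
  rewrite [in RHS](_ : (if _ then _ else _) = f i 0 * (-1) ^+ odd i); last first.
    by case: (odd i); rewrite ?mulrN1 ?mulr1.
  congr (_ * _); congr (\det _).
  by apply/matrixP => r c; rewrite !mxE.
elim: iota => [|i s IHs]; first by rewrite big_nil.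
rewrite big_cons IHs /=; case: eqP => // ->.
by rewrite oppr0 if_same mul0r add0r.
Qed.

Fixpoint all_seqs (n k : nat) : seq (seq nat) :=
  if k is k'.+1 then flatten [seq [seq a :: l | l <- all_seqs n k'] | a <- iota 0 n]
  else [:: [::]].

Lemma mem_all_seqs n k (J : k.-tuple 'I_n) : map val J \in all_seqs n k.
Proof.
elim: k J => [|k IH] J; first by rewrite (tuple0 J).
apply/flatten_mapP; exists (val (thead J)); first by rewrite mem_iota /=.
by apply/mapP; exists (map val [tuple of behead J]) => //; rewrite {1}[J]tuple_eta.
Qed.

(** Keeping only nonzero entries, with their values, lets the nested sums of the checks range over
    the few terms of a form instead of all multi-indices. *)
Definition support_seqs (n k : nat) (f : seq nat -> int) : seq (seq nat * int) :=
  [seq p <- [seq (l, f l) | l <- all_seqs n k] | p.2 != 0].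

Definition sum_support (s : seq (seq nat * int)) (g : seq nat -> int) : int :=
  foldr (fun p t => p.2 * g p.1 + t) 0 s.

Lemma sum_all_seqs (V : nmodType) n k (G : seq nat -> V) :
  \sum_(J : k.-tuple 'I_n) G (map val J) = \sum_(l <- all_seqs n k) G l.
Proof.
elim: k G => [|k IH] G; first by rewrite sum_tuple0 big_seq1.
rewrite sum_tuple_cons /= big_flatten big_map.
rewrite -[X in iota 0 X](subn0 n) -/(index_iota 0 n) big_mkord; apply: eq_bigr => a _.
by rewrite big_map -IH.
Qed.

Lemma sum_support_intr (R : comPzRingType) n k (f : seq nat -> int) (g : seq nat -> R) :
  \sum_(J : k.-tuple 'I_n) (f (map val J))%:~R * g (map val J) =
  \sum_(p <- support_seqs n k f) p.2%:~R * g p.1.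
Proof.
rewrite (sum_all_seqs _ _ (fun l => (f l)%:~R * g l)) /support_seqs.
elim: all_seqs => [|l s IH]; first by rewrite !big_nil.
by rewrite big_cons IH /=; case: eqP => [->|]; rewrite ?mul0r ?add0r // big_cons.
Qed.

Lemma sum_supportP n k f g :
  \sum_(J : k.-tuple 'I_n) f (map val J) * g (map val J) =
  sum_support (support_seqs n k f) g.
Proof.
have := sum_support_intr n k f g; under eq_bigr do rewrite intz.
move=> ->; elim: support_seqs => [|p s IH]; first by rewrite big_nil.
by rewrite big_cons IH intz.
Qed.

Definition dxZ (J l : seq nat) : int :=
  ldet 3 (fun r s => ((nth 0 l r).+1 == nth 0 J s)%N : int).

Definition phi_det (l : seq nat) : int :=
  dxZ [:: 1; 2; 3]%N l + dxZ [:: 1; 4; 5]%N l + dxZ [:: 1; 6; 7]%N l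
  + dxZ [:: 2; 4; 6]%N l - dxZ [:: 2; 5; 7]%N l - dxZ [:: 3; 4; 7]%N l
  - dxZ [:: 3; 5; 6]%N l.

(** Tabulated, as the finite checks below evaluate [phiZ] very often. *)
Definition phi_table : seq (seq (seq int)) := Eval vm_compute in
  [seq [seq [seq phi_det [:: a; b; c] | c <- iota 0 7] | b <- iota 0 7] | a <- iota 0 7].

Definition phiZ (l : seq nat) : int :=
  nth 0 (nth [::] (nth [::] phi_table (nth 0 l 0)) (nth 0 l 1)) (nth 0 l 2).

Lemma phi_detE (I : 3.-tuple 'I_7) : phi_det (map val I) = phiZ (map val I).
Proof.
have /allP/(_ _ (mem_all_seqs I))/eqP // : all (fun l => phi_det l == phiZ l) (all_seqs 7 3).
by vm_compute.
Qed.

(** The test [uniq l] only saves computation. *)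
Definition epsZ (l : seq nat) : int :=
  if uniq l then ldet 7 (fun r c => (nth 0 l r == c)%N : int) else 0.

Lemma det_intr (R : realType) n (f : nat -> nat -> int) :
  \det (\matrix_(r < n, c < n) (f r c)%:~R) = (ldet n f)%:~R :> R.
Proof.
rewrite -ldetP -[RHS](det_map_mx (intmul (1 : R))); congr (\det _).
by apply/matrixP => r c; rewrite !mxE.
Qed.

Lemma phi0Z (R : realType) I : @phi0 R I = (phiZ (map val I))%:~R.
Proof.
rewrite -phi_detE /phi0 !rmorphB !rmorphD /=.
have E (J : 3.-tuple nat) : dx R J I = (dxZ J (map val I))%:~R.
  rewrite -det_intr; congr (\det _); apply/matrixP => r c; rewrite !mxE.
  by rewrite (nth_map (tnth I r)) ?size_tuple // -tnth_nth -(tnth_nth _ J) /= pmulrn.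
by rewrite !E.
Qed.

Lemma det_tensorZ (R : realType) K : @det_tensor R 7 K = (epsZ (map val K))%:~R.
Proof.
rewrite /epsZ; case: ifPn => [_|].
  rewrite -det_intr; congr (\det _); apply/matrixP => r c; rewrite !mxE.
  by rewrite (nth_map (tnth K r)) ?size_tuple // -tnth_nth /= pmulrn.
rewrite (map_inj_uniq val_inj) => /(uniqPn 0)[a [b [ab]]]; rewrite size_tuple => b7 Kab.
have a7 := ltn_trans ab b7.
apply: (@determinant_alternate _ _ _ (Ordinal a7) (Ordinal b7)).
  by rewrite -val_eqE /= ltn_eqF.
by move=> c; rewrite !mxE !(tnth_nth 0) /= Kab.
Qed.

Definition phi_support := support_seqs 7 3 phiZ.
(** [144 = 6 * 2! * 2! * 3!]: the triple wedge in [metric_volume] for [phi0] is [6] times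
    the identity, and the sum over all indices does not divide by the factorials. *)
Definition volume_check : bool :=
  let phi_seq := phi_support in
  let om a := support_seqs 7 2 (fun l => phiZ (a :: l)) in
  let oms := map om (iota 0 7) in
  all (fun a => all (fun b =>
    sum_support (nth [::] oms a) (fun A => sum_support (nth [::] oms b) (fun B =>
       sum_support phi_seq (fun C => epsZ (A ++ B ++ C)))) == (if a == b then 144 else 0 : int))
    (iota 0 7)) (iota 0 7).

(** Twice the dual form of [phi0], written as the associator [<[e_a, e_b, e_c], e_d>]. *)
Definition psiZ (l : seq nat) : int :=
  if l is [:: a; b; c; d] then
    let s := iota 0 7 in
    foldr (fun e t => phiZ [:: a; b; e] * phiZ [:: e; c; d] - phiZ [:: b; c; e] * phiZ [:: a;
        e; d] + t) 0 s
    - (if (a == b) && (c == d) then 1 else 0) + (if (b == c) && (a == d) then 1 else 0)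
  else 0.
Definition psi_check : bool :=
  let phi_seq := phi_support in
  all (fun l => sum_support phi_seq (fun C => epsZ (C ++ l)) == 3 * psiZ l)
    (all_seqs 7 4).

Lemma volume_checkT : volume_check.
Proof. by vm_compute. Qed.

Lemma psi_checkT : psi_check.
Proof. by vm_compute. Qed.

Definition phi0_triple (R : realType) (a b : 'I_7) : tensor R 7 7 :=
  @tprod R 7 4 3 (@tprod R 7 2 2 (fun A => @phi0 R [tuple of a :: A])
                                 (fun B => @phi0 R [tuple of b :: B])) (@phi0 R).

Lemma map_val_cat m k l (A : k.-tuple 'I_m) (B : l.-tuple 'I_m) :
  map val [tuple of A ++ B] = map val A ++ map val B.
Proof. by rewrite map_cat. Qed.

Lemma sum_phi0_triple (R : realType) (a b : 'I_7) :
  \sum_J det_tensor R J * phi0_triple R a b J = 144 * (a == b)%:R.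
Proof.
rewrite (@sum_tuple_cat _ 7 4 3) (@sum_tuple_cat _ 7 2 2) /=.
transitivity ((\sum_(A : 2.-tuple 'I_7) phiZ (val a :: map val A) *
   \sum_(B : 2.-tuple 'I_7) phiZ (val b :: map val B) *
   \sum_(C : 3.-tuple 'I_7) phiZ (map val C) * epsZ (map val A ++ map val B ++ map val C))%:~R
       : R).
  rewrite rmorph_sum; apply: eq_bigr => A _; rewrite rmorphM rmorph_sum mulr_sumr.
  apply: eq_bigr => B _; rewrite rmorphM rmorph_sum !mulr_sumr.
  apply: eq_bigr => C _; rewrite rmorphM /phi0_triple.
  rewrite /tprod !lshift_tcat !rshift_tcat !phi0Z det_tensorZ !map_val_cat -catA /=.
  ring.
under eq_bigr => A _.
  under eq_bigr => B _ do rewrite (sum_supportP 7 3 phiZ (fun l => epsZ (map val A ++ map val B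
      ++ l))).
  rewrite (sum_supportP 7 2 (fun l => phiZ (val b :: l))
    (fun B => sum_support (support_seqs 7 3 phiZ) (fun C => epsZ (map val A ++ B ++ C)))).
  over.
rewrite (sum_supportP 7 2 (fun l => phiZ (val a :: l)) (fun A =>
  sum_support (support_seqs 7 2 (fun l => phiZ (val b :: l)))
   (fun B => sum_support (support_seqs 7 3 phiZ) (fun C => epsZ (A ++ B ++ C))))).
have H (c : 'I_7) : val c \in iota 0 7 by rewrite mem_iota /=.
have /allP/(_ _ (H a))/allP/(_ _ (H b))/eqP := volume_checkT.
have nthE (f : nat -> seq (seq nat * int)) (c : 'I_7) :
    nth [::] [seq f a | a <- iota 0 7] (val c) = f (val c).
  by rewrite (nth_map 0%N) ?size_iota ?ltn_ord // nth_iota ?ltn_ord.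
rewrite !nthE => ->.
rewrite val_eqE; case: (a == b); rewrite ?mulr1 ?mulr0 //.
Qed.

Definition psi0 (R : realType) : tensor R 7 4 :=
  fun N => 3`!%:R^-1 * \sum_(I : 3.-tuple 'I_7) @phi0 R I * det_tensor R [tuple of I ++ N].

Lemma psi0Z (R : realType) N : psi0 R N = 2^-1 * (psiZ (map val N))%:~R.
Proof.
rewrite /psi0; set X := \sum_I _.
have -> : X = 3 * (psiZ (map val N))%:~R.
  transitivity ((\sum_(C : 3.-tuple 'I_7) phiZ (map val C) * epsZ (map val C ++ map val N))%:~R
      : R).
    rewrite rmorph_sum; apply: eq_bigr => C _.
    by rewrite rmorphM phi0Z det_tensorZ map_val_cat.
  rewrite (sum_supportP 7 3 phiZ (fun l => epsZ (l ++ map val N))).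
  by have /allP/(_ _ (mem_all_seqs N))/eqP-> := psi_checkT; rewrite rmorphM.
by rewrite (_ : 3`! = 6)%N //; field.
Qed.

(** [P] pulls the triple wedge back from [phi0], where it is a multiple of the standard metric. The
    constant is [6 = 144 * 4! / (2! 2! 4! 3!)]: the wedges divide by [2! 2!] and [4! 3!], and
    dropping the inner antisymmetrization gives [4!]. *)
Lemma wedge_triple (R : realType) (P : 'M[R]_7) (w : tensor R 7 3) (u v : 'rV[R]_7) :
  w =1 pullback P (@phi0 R) ->
  wedge (wedge (contract u w) (contract v w)) w (ord_tuple 7) =
  6 * \det P * (u *m P *m (v *m P)^T) 0 0.
Proof.
move=> wP; have cP x : contract x w =1 pullback P (contract (x *m P) (@phi0 R)).
  move=> I; rewrite -pullback_contract; apply: eq_bigr => e _; by rewrite wP.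
rewrite wedgeE.
rewrite (@eq_alternate _ _ _ _ (fun I => 4^-1 * @tprod R 7 4 3
    (alternate (tprod (contract u w) (contract v w))) w I)); last first.
  by move=> I; rewrite /tprod wedgeE mulrA.
have -> (W : tensor R 7 7) : alternate (fun I => 4^-1 * W I) (ord_tuple 7) = 4^-1 * alternate W
    (ord_tuple 7).
  by rewrite /alternate mulr_sumr; apply: eq_bigr => s _; rewrite mulrCA.
rewrite (@alternate_tprod R 7 4 3).
rewrite (@eq_alternate _ _ _ _ (pullback P (tprod (tprod (contract (u *m P) (@phi0 R))
    (contract (v *m P) (@phi0 R))) (@phi0 R)))); last first.
  by move=> I; rewrite -pullback_tprod /tprod wP !cP -pullback_tprod.
rewrite alternate_pullback.
transitivity ((4`! * 3`!)%:R^-1 * (4^-1 * (4`!%:R * (\det P * \sum_a \sum_b (u *m P) 0 a * (v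
    *m P) 0 b *
   (\sum_J det_tensor R J * phi0_triple R a b J))))).
  congr (_ * (_ * (_ * _))); rewrite mulr_sumr.
  transitivity (\sum_J \sum_a \sum_b \det P * ((u *m P) 0 a * (v *m P) 0 b *
   (det_tensor R J * phi0_triple R a b J))).
    apply: eq_bigr => J _.
    have -> : \det (\matrix_(r, s) P (tnth (ord_tuple 7) s) (tnth J r)) = \det P * det_tensor R
        J.
      rewrite -(det_tr P) mulrC -det_mulmx; congr (\det _); apply/matrixP => r c.
      rewrite !mxE (bigD1 (tnth J r)) //= big1 ?addr0.
        by rewrite !mxE eqxx mul1r tnth_ord_tuple.
      by move=> b; rewrite mxE eq_sym => /negbTE->; rewrite mul0r.
    have -> : tprod (tprod (contract (u *m P) (@phi0 R)) (contract (v *m P) (@phi0 R)))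
        (@phi0 R) J = \sum_a \sum_b (u *m P) 0 a * (v *m P) 0 b * phi0_triple R a b J.
      rewrite /phi0_triple /tprod /contract !mulr_suml; apply: eq_bigr => a _.
      rewrite mulr_sumr mulr_suml; apply: eq_bigr => b _; ring.
    rewrite mulr_sumr; apply: eq_bigr => a _; rewrite mulr_sumr; apply: eq_bigr => b _; ring.
  rewrite exchange_big; apply: eq_bigr => a _; rewrite exchange_big mulr_sumr.
  by apply: eq_bigr => b _; rewrite !mulr_sumr.
have -> : \sum_a \sum_b (u *m P) 0 a * (v *m P) 0 b *
   (\sum_J det_tensor R J * phi0_triple R a b J) = 144 * (u *m P *m (v *m P)^T) 0 0.
  rewrite [in RHS]mxE mulr_sumr; apply: eq_bigr => a _.
  rewrite (bigD1 a) //= sum_phi0_triple eqxx big1 ?addr0.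
    by rewrite [(v *m P)^T a 0]mxE [true%:R]mulr1n; ring.
  by move=> b; rewrite sum_phi0_triple eq_sym => /negbTE->; rewrite !mulr0.
by rewrite (_ : 4`! = 24)%N // (_ : 3`! = 6)%N // natrM; field.
Qed.

Lemma innerE (R : realType) n (g : tensor R n 2) (X Y : 'rV[R]_n) :
  inner g X Y = (X *m metric_mx g *m Y^T) 0 0.
Proof.
rewrite mxE /inner exchange_big; apply: eq_bigr => b _ /=.
rewrite [in RHS]mxE mulr_suml; apply: eq_bigr => a _; rewrite !mxE; ring.
Qed.

Lemma inner_delta (R : realType) n (g : tensor R n 2) a b :
  inner g (delta_mx 0 a) (delta_mx 0 b) = metric_mx g a b.
Proof. by rewrite innerE -rowE trmx_delta -colE !mxE. Qed.

Lemma expr_odd_inj (R : realDomainType) n : odd n -> injective (fun x : R => x ^+ n).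
Proof.
move=> n_odd x y /= E.
have /eqP : `|x| = `|y|.
  apply/eqP; rewrite -(@eqrXn2 _ n) ?normr_ge0 ?odd_gt0 //.
  by rewrite -!normrX E.
rewrite eqr_norm2 => /orP[/eqP//|/eqP xE]; move: E.
rewrite xE exprNn -signr_odd n_odd expr1 mulN1r => /eqP.
rewrite eq_sym -addr_eq0 -mulr2n mulrn_eq0 /= expf_eq0 => /andP[_ /eqP->].
by rewrite oppr0.
Qed.

(** Positivity supplies [P] for the form alone. That the recorded metric and volume are those
    transported by [P] comes from [metric_volume], which gives [v0 g = \det P (P P^T)] and leaves a
    scalar free; [v0^2 = \det g] fixes it. *)
Lemma G2_frame (R : realType) (M : manifold R 7) (S : G2_structure M) i p :
  dom i p -> exists P : 'M[R]_7,
  [/\ P \in unitmx, G2_form S i p =1 pullback P (@phi0 R),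
      metric_mx (metric S i p) = P *m P^T
    & dual_form S i p =1 pullback P (psi0 R)].
Proof.
move=> ip; have [P PU Pphi] := G2_form_positive S ip; exists P.
have [[_ valt] vdet] := volume_volume_form S.
set v0 := volume S i p (ord_tuple 7).
have gE : v0 *: metric_mx (metric S i p) = \det P *: (P *m P^T).
  apply/matrixP => a b; rewrite [in LHS]mxE -(inner_delta (metric S i p)).
  rewrite mulrC (metric_volume S ip) (wedge_triple _ _ Pphi) [in RHS]mxE.
  rewrite trmx_mul !mulmxA -(mulmxA (delta_mx 0 a)) -rowE trmx_delta -colE.
  by rewrite 2!mxE -mulrA mulKf ?pnatr_eq0.
have v0E : v0 = \det P.
  (* Determinants in dimension 7, with [\det g = v0^2], give the exponent [7 + 2]. It is odd, so the
     sign, and with it the orientation, is determined too. *)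
  have : v0 ^+ 9 = \det P ^+ 9.
    have := congr1 determinant gE; rewrite !detZ -(vdet _ _ ip) det_mulmx det_tr.
    by rewrite -/v0 -expr2 -!exprD.
  exact: expr_odd_inj.
have gP : metric_mx (metric S i p) = P *m P^T.
  apply: (@scalerI _ _ v0); last by rewrite gE v0E.
  by rewrite v0E -unitfE -unitmxE.
split=> // J.
rewrite -(hodge_pullback _ _ _ PU gP).
congr (_ * _); apply: eq_bigr => I _; congr (_ * _); first exact: eq_pullback.
by rewrite (alternating_top _ (valt _ _ ip)) pullback_det_tensor -v0E.
Qed.

(** * Octonion algebra in a frame *)

(** The associators of [t] with the pairs [e1, e2], then [e4, e5], then [e4, e6] already exhibit all
    seven coordinates of [t], up to factors 2 and -2. *)
Lemma assoc8_nondegenerate (R : realFieldType) (t : oct8 R) :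
  o0 t = 0 ->
  (forall x y, o0 x = 0 -> o0 y = 0 -> assoc8 x y t = Oct8 0 0 0 0 0 0 0 0) ->
  t = Oct8 0 0 0 0 0 0 0 0.
Proof.
case: t => ? t1 t2 t3 t4 t5 t6 t7 /= -> H.
have := H (Oct8 0 1 0 0 0 0 0 0) (Oct8 0 0 1 0 0 0 0 0) erefl erefl.
have -> : assoc8 (Oct8 0 1 0 0 0 0 0 0) (Oct8 0 0 1 0 0 0 0 0) (Oct8 0 t1 t2 t3 t4 t5 t6 t7)
    = Oct8 0 0 0 0 (2 * t7) (2 * t6) (- (2 * t5)) (- (2 * t4)).
  by rewrite /assoc8 /=; congr Oct8; ring.
have := H (Oct8 0 0 0 0 1 0 0 0) (Oct8 0 0 0 0 0 1 0 0) erefl erefl.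
have -> : assoc8 (Oct8 0 0 0 0 1 0 0 0) (Oct8 0 0 0 0 0 1 0 0) (Oct8 0 t1 t2 t3 t4 t5 t6 t7)
    = Oct8 0 0 (- (2 * t3)) (2 * t2) 0 0 (- (2 * t7)) (2 * t6).
  by rewrite /assoc8 /=; congr Oct8; ring.
have := H (Oct8 0 0 0 0 1 0 0 0) (Oct8 0 0 0 0 0 0 1 0) erefl erefl.
have -> : assoc8 (Oct8 0 0 0 0 1 0 0 0) (Oct8 0 0 0 0 0 0 1 0) (Oct8 0 t1 t2 t3 t4 t5 t6 t7)
    = Oct8 0 (2 * t3) 0 (- (2 * t1)) 0 (2 * t7) 0 (- (2 * t5)).
  by rewrite /assoc8 /=; congr Oct8; ring.
by move=> [e3 e1 _ _] [_ e2 _ _] [e7 e6 e5 e4]; congr Oct8; lra.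
Qed.

(** * Tensors as multilinear functions of vectors *)

Definition teval (R : realType) n k (w : tensor R n k) (X : k.-tuple 'rV[R]_n) : R :=
  \sum_I (\prod_(r < k) tnth X r 0 (tnth I r)) * w I.

Section Teval.
Variables (R : realType) (n : nat).

Lemma eq_teval k (u v : tensor R n k) X : u =1 v -> teval u X = teval v X.
Proof. by move=> uv; apply: eq_bigr => I _; rewrite uv. Qed.

Lemma teval_pullback k (P : 'M[R]_n) (w : tensor R n k) X :
  teval (pullback P w) X = teval w [tuple tnth X r *m P | r < k].
Proof.
rewrite /teval /pullback; under eq_bigr do rewrite mulr_sumr.
rewrite exchange_big; apply: eq_bigr => J _ /=.
transitivity ((\sum_(I : k.-tuple 'I_n) \prod_(r < k) (tnth X r 0 (tnth I r) * P (tnth I r)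
    (tnth J r))) * w J).
  by rewrite mulr_suml; apply: eq_bigr => I _; rewrite big_split mulrA.
rewrite (sum_tuple_prod (fun r b => tnth X r 0 b * P b (tnth J r))); congr (_ * _).
by apply: eq_bigr => r _; rewrite tnth_mktuple mxE.
Qed.

Lemma teval_cons k (w : tensor R n k.+1) x (X : k.-tuple 'rV[R]_n) :
  teval w [tuple of x :: X] = teval (contract x w) X.
Proof.
rewrite /teval sum_tuple_cons exchange_big; apply: eq_bigr => J _ /=.
rewrite /contract mulr_sumr; apply: eq_bigr => a _; rewrite big_ord_recl mulrCA -mulrA.
by congr (_ * (_ * _)); apply: eq_bigr => r _; rewrite !(tnth_nth a) !(tnth_nth 0).
Qed.

(** Reindexing moves each permutation from the slots to the vectors, where the signed sum is a
    determinant. *)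
Lemma teval_alternate k (w : tensor R n k) X :
  teval (alternate w) X =
  \sum_J \det (\matrix_(r < k, s < k) tnth X s 0 (tnth J r)) * w J.
Proof.
rewrite /teval /alternate; under eq_bigr do rewrite mulr_sumr.
rewrite exchange_big /=.
under [RHS]eq_bigr do rewrite mulr_suml.
rewrite [RHS]exchange_big; apply: eq_bigr => s _ /=.
rewrite (reindex (fun J : k.-tuple 'I_n => [tuple tnth J (s^-1%g r) | r < k])) /=; last first.
  exists (fun J : k.-tuple 'I_n => [tuple tnth J (s r) | r < k]) => J _;
  by apply: eq_from_tnth => r; rewrite !tnth_mktuple ?permK ?permKV.
apply: eq_bigr => J _; rewrite mulrCA mulrA; congr (_ * _ * w _).
  rewrite (reindex_inj (@perm_inj _ s)); apply: eq_bigr => r _.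
  by rewrite mxE tnth_mktuple permK.
by apply: eq_from_tnth => r; rewrite !tnth_mktuple permK.
Qed.

End Teval.

Lemma det3 (R : comPzRingType) (f : nat -> nat -> R) :
  \det (\matrix_(r < 3, s < 3) f r s) =
  f 0 0 * (f 1 1 * f 2 2 - f 1 2 * f 2 1) - f 0 1 * (f 1 0 * f 2 2 - f 1 2 * f 2 0)
  + f 0 2 * (f 1 0 * f 2 1 - f 1 1 * f 2 0).
Proof.
rewrite (expand_det_row _ ord0) !big_ord_recl big_ord0 /cofactor.
rewrite !(expand_det_row _ ord0) !big_ord_recl !big_ord0 /cofactor !det_mx11 !mxE /=.
rewrite /bump /=; ring.
Qed.

Lemma sum_rV7 (R : realType) (F : 'I_7 -> R) :
  \sum_i F i = F (inord 0) + F (inord 1) + F (inord 2) + F (inord 3) + F (inord 4)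
    + F (inord 5) + F (inord 6).
Proof.
transitivity (\sum_(k <- iota 0 7) F (inord k)).
  rewrite -[iota 0 7]/(index_iota 0 7) big_mkord; apply: eq_bigr => i _.
  by rewrite inord_val.
by rewrite /= !big_cons big_nil addr0 !addrA.
Qed.

Definition coord8 (R : realType) (A : octonion R) : oct8 R :=
  Oct8 A.1 (A.2 0 (inord 0)) (A.2 0 (inord 1)) (A.2 0 (inord 2)) (A.2 0 (inord 3))
    (A.2 0 (inord 4)) (A.2 0 (inord 5)) (A.2 0 (inord 6)).

Lemma teval_intr (R : realType) k (f : seq nat -> int) (X : k.-tuple 'rV[R]_7) :
  teval (fun I => (f (map val I))%:~R) X =
  \sum_(p <- support_seqs 7 k f) p.2%:~R *
    \prod_(r <- iota 0 k) (nth 0 X r) 0 (inord (nth 0%N p.1 r)).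
Proof.
under [RHS]eq_bigr do rewrite -[X in iota 0 X](subn0 k) -/(index_iota 0 k) big_mkord.
rewrite -(sum_support_intr 7 k f (fun l => \prod_(r < k) (nth 0 X r) 0 (inord (nth 0%N l r)))).
apply: eq_bigr => I _; rewrite mulrC; congr (_ * _); apply: eq_bigr => r _.
by rewrite (nth_map (tnth I r)) ?size_tuple // -!tnth_nth inord_val.
Qed.

(** The support is a closed list of integers; it is replaced by its value, with the conversion left
    to the virtual machine. What remains is an explicit polynomial for [ring]. *)
Local Ltac compute_support :=
  match goal with |- context [support_seqs ?n ?k ?f] =>
    let s := constr:(support_seqs n k f) in
    let v := eval vm_compute in s in
    have -> : s = v by vm_cast_no_check (erefl v)
  end.

Lemma teval_phi0 (R : realType) (x y z : 'rV[R]_7) :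
  teval (@phi0 R) [tuple x; y; z] =
  dot8 (mul8 (coord8 (0, x)) (coord8 (0, y))) (coord8 (0, z)).
Proof.
rewrite (eq_teval _ (@phi0Z R)) teval_intr.
compute_support.
rewrite unlock /= /coord8 /=.
ring.
Qed.

Lemma teval_psi0 (R : realType) (t x y z : 'rV[R]_7) :
  teval (psi0 R) [tuple t; x; y; z] =
  2^-1 * dot8 (assoc8 (coord8 (0, t)) (coord8 (0, x)) (coord8 (0, y))) (coord8 (0, z)).
Proof.
transitivity (2^-1 * teval (fun I : 4.-tuple 'I_7 => (psiZ (map val I))%:~R : R) [tuple t; x;
    y; z]).
  by rewrite /teval mulr_sumr; apply: eq_bigr => I _; rewrite psi0Z mulrCA.
congr (_ * _); rewrite teval_intr.
compute_support.
rewrite unlock /= /coord8 /assoc8 /=.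
ring.
Qed.

(** The frame [P] identifies the tangent space with the imaginary part of the
    standard octonions. *)
Section Frame.
Variables (R : realType) (g : tensor R 7 2) (phi : tensor R 7 3) (P : 'M[R]_7).
Hypothesis PU : P \in unitmx.
Hypothesis gP : metric_mx g = P *m P^T.
Hypothesis phiP : phi =1 pullback P (@phi0 R).

Definition frame8 (A : octonion R) : oct8 R := coord8 (A.1, A.2 *m P).

Lemma inner_frame x y : inner g x y = dot8 (frame8 (0, x)) (frame8 (0, y)).
Proof.
rewrite innerE gP mulmxA -mulmxA -trmx_mul mxE sum_rV7 /= mulr0 add0r.
by rewrite ![(y *m P)^T _ _]mxE.
Qed.

Lemma oct_inner_frame A B : oct_inner g A B = dot8 (frame8 A) (frame8 B).
Proof. by rewrite /oct_inner inner_frame /= mul0r add0r. Qed.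

Lemma frame8_inj : injective frame8.
Proof.
move=> [a x] [b y] [-> E0 E1 E2 E3 E4 E5 E6]; congr pair.
apply: (can_inj (mulmxK PU)); apply/rowP => c.
rewrite -[c]inord_val; case: c => [[|[|[|[|[|[|[|//]]]]]]] ?] //=.
Qed.

Lemma frame8D A B : frame8 (A + B) = add8 (frame8 A) (frame8 B).
Proof. by rewrite /frame8 mulmxDl /coord8 /= !mxE. Qed.

Lemma frame8N A : frame8 (- A) = opp8 (frame8 A).
Proof. by rewrite /frame8 mulNmx /coord8 /= !mxE. Qed.

Lemma frame8Z k A : frame8 (k * A.1, k *: A.2) = scale8 k (frame8 A).
Proof. by rewrite /frame8 -scalemxAl /coord8 /= !mxE. Qed.

Lemma frame8_conj A : frame8 (oct_conj A) = conj8 (frame8 A).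
Proof. by rewrite /frame8 mulNmx /coord8 /= !mxE. Qed.

Lemma frame8_surj t : exists A, frame8 A = t.
Proof.
case: t => a t1 t2 t3 t4 t5 t6 t7.
exists (a, (\row_(c < 7) [:: t1; t2; t3; t4; t5; t6; t7]`_c) *m invmx P).
by rewrite /frame8 /= mulmxKV // /coord8 /= !mxE !inordK.
Qed.

Lemma im_frame8 A : im8 (frame8 A) = frame8 (0, A.2).
Proof. by []. Qed.

Lemma metric_mx_frame_unit : metric_mx g \in unitmx.
Proof. by rewrite gP unitmx_mul unitmx_tr PU. Qed.

Lemma inner_sharp (w : tensor R 7 1) x : inner g (sharp g w) x = teval w [tuple x].
Proof.
have -> : sharp g w = (\row_a w [tuple a]) *m invmx (metric_mx g).
  by apply/rowP => b; rewrite !mxE; apply: eq_bigr => a _; rewrite mxE.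
rewrite innerE mulmxKV ?metric_mx_frame_unit // mxE /teval sum_tuple_cons.
apply: eq_bigr => a _; rewrite sum_tuple0 big_ord_recl big_ord0 !mxE mulr1 mulrC.
by congr (_ * w _); apply/val_inj.
Qed.

Lemma inner_cross x y z : inner g (cross g phi x y) z = teval phi [tuple x; y; z].
Proof.
rewrite inner_sharp -(teval_cons _ _ [tuple z]) -(teval_cons _ _ [tuple y; z]).
congr teval; exact/val_inj.
Qed.

Lemma teval_phi_frame x y z :
  teval phi [tuple x; y; z] =
  dot8 (mul8 (frame8 (0, x)) (frame8 (0, y))) (frame8 (0, z)).
Proof.
rewrite (eq_teval _ phiP) teval_pullback -teval_phi0; congr teval.
by apply: eq_from_tnth => r; rewrite tnth_mktuple !(tnth_nth 0); case: r => [[|[|[|]]]].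
Qed.

Lemma dot8_frame_inj s t :
  (forall A, dot8 s (frame8 A) = dot8 t (frame8 A)) -> s = t.
Proof.
move=> E; have {}E u : dot8 s u = dot8 t u by have [A <-] := frame8_surj u.
case: s t E => ???????? [????????] E.
have := E (Oct8 1 0 0 0 0 0 0 0); have := E (Oct8 0 1 0 0 0 0 0 0).
have := E (Oct8 0 0 1 0 0 0 0 0); have := E (Oct8 0 0 0 1 0 0 0 0).
have := E (Oct8 0 0 0 0 1 0 0 0); have := E (Oct8 0 0 0 0 0 1 0 0).
have := E (Oct8 0 0 0 0 0 0 1 0); have := E (Oct8 0 0 0 0 0 0 0 1).
rewrite /= !(mulr0, mulr1, add0r, addr0).
by do 8 move=> ->.
Qed.

(** The cross product is defined by duality, so both sides are compared through inner products with
    an arbitrary [C]. *)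
Lemma frame8_mul A B : frame8 (oct_mul g phi A B) = mul8 (frame8 A) (frame8 B).
Proof.
apply: dot8_frame_inj => C; rewrite -oct_inner_frame /oct_inner.
have innerDl x y : inner g (x + y) C.2 = inner g x C.2 + inner g y C.2.
  by rewrite !innerE !mulmxDl mxE.
have innerZl k x : inner g (k *: x) C.2 = k * inner g x C.2.
  by rewrite !innerE -!scalemxAl mxE.
rewrite /= !innerDl !innerZl inner_cross teval_phi_frame !inner_frame /=.
ring.
Qed.

End Frame.

(** All six permutations appear, with [2^-1 = 1 / (1! 2!)]; for an alternating [v] they coincide in
    pairs. *)
Lemma teval_wedge12 (R : realType) n (u : tensor R n 1) (v : tensor R n 2) x y z :
  teval (@wedge R n 1 2 u v) [tuple x; y; z] = 2^-1 *
  (teval u [tuple x] * teval v [tuple y; z] - teval u [tuple x] * teval v [tuple z; y]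
   + teval u [tuple y] * teval v [tuple z; x] - teval u [tuple y] * teval v [tuple x; z]
   + teval u [tuple z] * teval v [tuple x; y] - teval u [tuple z] * teval v [tuple y; x]).
Proof.
have E (a b c : 'rV[R]_n) :
    \sum_(J : 3.-tuple 'I_n) a 0 (tnth J 0) * (b 0 (tnth J 1) * c 0 (tnth J 2)) * @tprod R n 1
        2 u v J =
    teval u [tuple a] * teval v [tuple b; c].
  rewrite (@sum_tuple_cat _ n 1 2) /teval mulr_suml; apply: eq_bigr => A _.
  rewrite mulr_sumr; apply: eq_bigr => B _.
  rewrite /tprod lshift_tcat rshift_tcat !big_ord_recl !big_ord0 !mulr1 [RHS]mulrACA.
  congr (_ * (_ * _) * _).
  - congr (_ 0 _); transitivity (tnth [tuple of A ++ B] (lshift 2 ord0)); last by rewrite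
      tnth_lshift.
    by congr tnth; apply/val_inj.
  - congr (_ 0 _); transitivity (tnth [tuple of A ++ B] (rshift 1 ord0)); last by rewrite
      tnth_rshift.
    by congr tnth; apply/val_inj.
  - congr (_ 0 _); transitivity (tnth [tuple of A ++ B] (rshift 1 (lift ord0 ord0))); last by
      rewrite tnth_rshift.
    by congr tnth; apply/val_inj.
rewrite (eq_teval _ (@wedgeE R n 1 2 u v)).
transitivity ((1`! * 2`!)%:R^-1 * teval (alternate (@tprod R n 1 2 u v)) [tuple x; y; z]).
  by rewrite /teval mulr_sumr; apply: eq_bigr => I _; rewrite mulrCA.
congr (_^-1 * _); rewrite teval_alternate -!E -!sumrB -!big_split -!sumrB -!big_split -!sumrB
    /=.
apply: eq_bigr => J _; pose X := [:: x; y; z].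
have -> : \matrix_(r, s) tnth [tuple x; y; z] s 0 (tnth J r) =
    \matrix_(r < 3, s < 3) (fun i j => X`_j 0 (tnth J (inord i))) r s.
  by apply/matrixP => r s; rewrite !mxE inord_val (tnth_nth 0).
rewrite (det3 (fun i j => X`_j 0 (tnth J (inord i)))) /=.
have -> : inord 0 = 0 :> 'I_3 by apply/val_inj; rewrite /= inordK.
have -> : inord 1 = 1 :> 'I_3 by apply/val_inj; rewrite /= inordK.
have -> : inord 2 = 2 :> 'I_3 by apply/val_inj; rewrite /= inordK.
ring.
Qed.

(** * Octonion identities on a tangent space *)

Section FrameAlgebra.
Variables (R : realType) (g : tensor R 7 2) (phi : tensor R 7 3) (P : 'M[R]_7).
Hypothesis PU : P \in unitmx.
Hypothesis gP : metric_mx g = P *m P^T.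
Hypothesis phiP : phi =1 pullback P (@phi0 R).

Local Notation mul := (oct_mul g phi).
Local Notation fr := (@frame8 R P).
Let frM := frame8_mul PU gP phiP.
Let frI := frame8_inj PU.
Let frD := frame8D P.
Let frN := frame8N P.

Definition oct_assoc (A B C : octonion R) := mul (mul A B) C - mul A (mul B C).

Lemma frame8_assoc A B C : fr (oct_assoc A B C) = assoc8 (fr A) (fr B) (fr C).
Proof. by rewrite frD frN !frM. Qed.

Lemma oct_mulDl A B C : mul (A + B) C = mul A C + mul B C.
Proof. by apply: frI; rewrite frM !frD !frM mul8Dl. Qed.

Lemma oct_mulDr A B C : mul A (B + C) = mul A B + mul A C.
Proof. by apply: frI; rewrite frM !frD !frM mul8Dr. Qed.

Lemma oct_mulNl A B : mul (- A) B = - mul A B.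
Proof. by apply: frI; rewrite frM !frN !frM mul8Nl. Qed.

Lemma oct_mulNr A B : mul A (- B) = - mul A B.
Proof. by apply: frI; rewrite frM !frN !frM mul8Nr. Qed.

Lemma oct_mulZl k A B : mul (k * A.1, k *: A.2) B = (k * (mul A B).1, k *: (mul A B).2).
Proof. by apply: frI; rewrite frM !frame8Z frM mul8Zl. Qed.

Lemma oct_assocC A B C : oct_assoc A B C = oct_assoc B C A.
Proof. by apply: frI; rewrite !frame8_assoc assoc8C. Qed.

Lemma re_oct_assoc A B C : (oct_assoc A B C).1 = 0.
Proof. by rewrite -[LHS]/(o0 (fr _)) frame8_assoc re_assoc8. Qed.

Lemma re_oct_mul_conj A B : (mul A (oct_conj B)).1 = oct_inner g A B.
Proof.
by rewrite -[LHS]/(o0 (fr _)) frM frame8_conj re_mul8_conj (oct_inner_frame gP).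
Qed.

Lemma oct_assoc_nondegenerate t :
  t.1 = 0 -> (forall x y, oct_assoc (0, x) (0, y) t = 0) -> t = 0.
Proof.
have fr0 : fr 0 = Oct8 0 0 0 0 0 0 0 0 by rewrite -[0 in LHS](subrr 0) frD frN add8N.
move=> t0 H; apply: frI; rewrite fr0; apply: assoc8_nondegenerate => // u v.
have [[a x] <-] := frame8_surj PU u; have [[b y] <-] := frame8_surj PU v.
rewrite /= => a0 b0; rewrite -frame8_assoc -fr0; congr fr.
by rewrite a0 b0 H.
Qed.

Lemma oct_mul_conjK A B : mul (oct_conj A) (mul A B) = (oct_inner g A A * B.1, oct_inner g A A
    *: B.2).
Proof.
apply: frI; rewrite !frM frame8_conj mul8_conjl -(oct_inner_frame gP).
by rewrite frame8Z.
Qed.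

Lemma oct_assoc_im A B C : oct_assoc A B C = oct_assoc A (0, B.2) (0, C.2).
Proof. by apply: frI; rewrite !frame8_assoc -!im_frame8 -assoc8_im. Qed.

Lemma oct_assocBr A B C D : oct_assoc A B (C - D) = oct_assoc A B C - oct_assoc A B D.
Proof. by apply: frI; rewrite frD frN !frame8_assoc frD frN assoc8Br. Qed.

(** Right multiplication by an imaginary octonion is skew. The torsion term of [DV] has this shape,
    hence is orthogonal to [V]. *)
Lemma oct_inner_mulr A t : t.1 = 0 -> oct_inner g (mul A t) A = 0.
Proof. by move=> t0; rewrite (oct_inner_frame gP) frM dot8_mulr [o0 _]t0 mulr0. Qed.

Lemma oct_mul1 A : mul (1, 0) A = A.
Proof.
apply: frI; rewrite frM [fr (1, 0)](_ : _ = Oct8 1 0 0 0 0 0 0 0) ?mul1_8 //.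
by rewrite /frame8 /= mul0mx /coord8 /= !mxE.
Qed.

Lemma oct_innerC A B : oct_inner g A B = oct_inner g B A.
Proof. by rewrite !(oct_inner_frame gP) dot8C. Qed.

Section UnitOctonion.
Variable V : octonion R.
Hypothesis V1 : oct_inner g V V = 1.

Lemma oct_inv_unit : oct_inv g V = oct_conj V.
Proof. by rewrite /oct_inv V1 invr1 mul1r scale1r. Qed.

Let frV : dot8 (fr V) (fr V) = 1.
Proof. by rewrite -(oct_inner_frame gP). Qed.

Lemma scale8_1 (u : oct8 R) : scale8 1 u = u.
Proof. by case: u => * /=; rewrite !mul1r. Qed.

Lemma oct_mulK A : mul (mul A V) (oct_inv g V) = A.
Proof. by apply: frI; rewrite oct_inv_unit !frM frame8_conj mul8_conjr frV scale8_1. Qed.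

Lemma oct_mulVK A : mul (mul A (oct_inv g V)) V = A.
Proof.
have conj8K (u : oct8 R) : conj8 (conj8 u) = u by case: u => * /=; rewrite !opprK.
have dot8J (u : oct8 R) : dot8 (conj8 u) (conj8 u) = dot8 u u by case: u => * /=; ring.
apply: frI; rewrite oct_inv_unit !frM frame8_conj -{2}[fr V]conj8K mul8_conjr dot8J frV.
by rewrite scale8_1.
Qed.

End UnitOctonion.

Variable psi : tensor R 7 4.
Hypothesis psiP : psi =1 pullback P (psi0 R).

Lemma teval_psi_frame t x y z :
  2 * teval psi [tuple t; x; y; z] =
  dot8 (assoc8 (fr (0, t)) (fr (0, x)) (fr (0, y))) (fr (0, z)).
Proof.
rewrite (eq_teval _ psiP) teval_pullback.
have -> : [tuple tnth [tuple t; x; y; z] r *m P | r < 4] = [tuple t *m P; x *m P; y *m P; z *m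
    P].
  by apply: eq_from_tnth => r; rewrite tnth_mktuple !(tnth_nth 0); case: r => [[|[|[|[|]]]]].
by rewrite teval_psi0 mulVKf ?pnatr_eq0.
Qed.

Lemma teval_psi_assoc t x y z :
  2 * teval psi [tuple t; x; y; z] = inner g (oct_assoc (0, t) (0, x) (0, y)).2 z.
Proof.
rewrite teval_psi_frame -frame8_assoc (inner_frame gP); congr dot8.
by case: (oct_assoc _ _ _) (re_oct_assoc (0, t) (0, x) (0, y)) => r v /= ->.
Qed.

Lemma flat_eval x y : teval (flat g x) [tuple y] = inner g x y.
Proof.
rewrite /teval sum_tuple_cons /inner [RHS]exchange_big; apply: eq_bigr => b _ /=.
rewrite sum_tuple0 big_ord_recl big_ord0 mulr1 /flat mulr_sumr; apply: eq_bigr => a _.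
by rewrite !(tnth_nth b) /=; ring.
Qed.

(** Pairing with [C] reduces this to [dot8_twisted_mul], term by term. The metric on both sides is
    [g], the one belonging to [phi]; that [sigma_V(phi)] determines the same metric is deduced later
    from this identity. *)
Lemma twisted_mul V (w : tensor R 7 3) A B :
  oct_inner g V V = 1 ->
  (forall I, w I = (oct_inner g V V)^-1 *
      ((V.1 ^+ 2 - inner g V.2 V.2) * phi I - 2 * V.1 * contract V.2 psi I
       + 2 * wedge (flat g V.2) (contract V.2 phi) I)) ->
  oct_mul g w A B = mul (mul A (mul B V)) (oct_inv g V).
Proof.
move=> V1 wE; apply: frI; rewrite (oct_inv_unit V1) !frM frame8_conj.
apply: (dot8_frame_inj PU) => C; rewrite dot8_twisted_mul.
rewrite -!(oct_inner_frame gP) V1 mul1r /oct_inner.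
have innerDl x y : inner g (x + y) C.2 = inner g x C.2 + inner g y C.2.
  by rewrite !innerE !mulmxDl mxE.
have innerZl k x : inner g (k *: x) C.2 = k * inner g x C.2.
  by rewrite !innerE -!scalemxAl mxE.
rewrite [in LHS]/= !innerDl !innerZl (inner_cross _ PU gP).
(* The factor 2 of the [psi] term makes an associator, and the factor 2 of the wedge cancels its
   [2^-1]. *)
have -> : teval w [tuple A.2; B.2; C.2] =
   (V.1 ^+ 2 - inner g V.2 V.2) * teval phi [tuple A.2; B.2; C.2]
   - V.1 * (2 * teval psi [tuple V.2; A.2; B.2; C.2])
   + (inner g V.2 A.2 * teval phi [tuple V.2; B.2; C.2] - inner g V.2 A.2 * teval phi [tuple
       V.2; C.2; B.2]
     + inner g V.2 B.2 * teval phi [tuple V.2; C.2; A.2] - inner g V.2 B.2 * teval phi [tuple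
         V.2; A.2; C.2]
     + inner g V.2 C.2 * teval phi [tuple V.2; A.2; B.2] - inner g V.2 C.2 * teval phi [tuple
         V.2; B.2; A.2]).
  have tc x y : teval (contract V.2 phi) [tuple x; y] = teval phi [tuple V.2; x; y].
    by rewrite -teval_cons; congr teval; apply/val_inj.
  have -> : teval psi [tuple V.2; A.2; B.2; C.2] = teval (contract V.2 psi) [tuple A.2; B.2;
      C.2].
    by rewrite -teval_cons; congr teval; apply/val_inj.
  transitivity ((V.1 ^+ 2 - inner g V.2 V.2) * teval phi [tuple A.2; B.2; C.2]
    - V.1 * (2 * teval (contract V.2 psi) [tuple A.2; B.2; C.2])
    + 2 * teval (@wedge R 7 1 2 (flat g V.2) (contract V.2 phi)) [tuple A.2; B.2; C.2]).
    rewrite /teval !mulr_sumr -sumrB -big_split /=; apply: eq_bigr => I _.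
    by rewrite wE V1 invr1 mul1r; ring.
  by rewrite teval_wedge12 !flat_eval !tc; field.
rewrite teval_psi_frame !(teval_phi_frame phiP) !im_frame8 !(inner_frame gP).
have re D : o0 (fr D) = D.1 by [].
rewrite !re; ring.
Qed.

End FrameAlgebra.

(** * The metric of the transformed structure *)

(** The Weinstein-Aronszajn identity, from two triangular factorizations of one block matrix. It
    evaluates determinants of rank one perturbations of the identity. *)
Lemma det_add1_mulmx (F : comUnitRingType) m n (u : 'M[F]_(m, n)) (v : 'M[F]_(n, m)) :
  \det (1%:M + u *m v) = \det (1%:M + v *m u).
Proof.
have E1 : block_mx 1%:M (- u) v 1%:M = block_mx 1%:M 0 v 1%:M *m block_mx 1%:M (- u) 0 (1%:M +
    v *m u).
  by rewrite mulmx_block !mul1mx !mul0mx !mulmx1 !addr0 mulmxN addrCA addNr addr0.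
have E2 : block_mx 1%:M (- u) v 1%:M = block_mx (1%:M + u *m v) (- u) 0 1%:M *m block_mx 1%:M 0
    v 1%:M.
  by rewrite mulmx_block !mulmx1 !mul1mx !mul0mx !mulmx0 !add0r mulNmx addrK.
have := congr1 determinant E1.
by rewrite E2 !det_mulmx !det_ublock !det_lblock !det1 !mul1r !mulr1.
Qed.

Section VectorProductMetric.
Variable F : fieldType.
Implicit Types (W G : 'M[F]_7) (x : 'rV[F]_7) (f : 'cV[F]_7).

(** [W + f f^T] and [W + f' f'^T] are congruent through [1 + k x] with [k] a multiple
    of [f' - f], because [W] vanishes on [x]. *)
Lemma det_rank1_change W x f f' :
  x *m W = 0 -> W *m x^T = 0 -> (x *m f) 0 0 != 0 ->
  \det (W + f' *m f'^T) * (x *m f) 0 0 ^+ 2 = (x *m f') 0 0 ^+ 2 * \det (W + f *m f^T).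
Proof.
move=> xW Wx xf; pose k := ((x *m f) 0 0)^-1 *: (f' - f).
pose Q := 1%:M + k *m x.
have QW : Q *m W = W by rewrite mulmxDl mul1mx -mulmxA xW mulmx0 addr0.
have WQ : W *m Q^T = W.
  by rewrite linearD /= trmx1 trmx_mul mulmxDr mulmx1 mulmxA Wx mul0mx addr0.
have Qf : Q *m f = f'.
  rewrite mulmxDl mul1mx -mulmxA [x *m f]mx11_scalar mul_mx_scalar scalerA mulfV //.
  by rewrite scale1r addrC subrK.
have dQ : \det Q = (x *m f') 0 0 / (x *m f) 0 0.
  have xk : (x *m k) 0 0 = ((x *m f) 0 0)^-1 * ((x *m f') 0 0 - (x *m f) 0 0).
    rewrite -scalemxAr mulmxBr [LHS]mxE; congr (_ * _).
    by rewrite [LHS]mxE [X in _ + X]mxE.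
  by rewrite det_add1_mulmx det_mx11 [LHS]mxE xk [1%:M 0 0]mxE eqxx mulr1n; field.
have -> : W + f' *m f'^T = Q *m (W + f *m f^T) *m Q^T.
  by rewrite mulmxDr QW mulmxDl WQ mulmxA Qf -mulmxA -trmx_mul Qf.
by rewrite !det_mulmx det_tr dQ; field.
Qed.

(** With [f] dual to [x], the square of [(W + f f^T) G^-1] is a scalar plus a rank one
    matrix. *)
Lemma det_vector_product W G x (s := (x *m G *m x^T) 0 0) :
  G \in unitmx -> G^T = G -> x *m W = 0 -> W *m x^T = 0 -> s != 0 ->
  W *m invmx G *m W *m invmx G = - s%:M + G *m x^T *m x ->
  \det (W + G *m x^T *m (G *m x^T)^T) ^+ 2 = s ^+ 8 * \det G ^+ 2.
Proof.
move=> GU Gs xW Wx s0 WW; set f := G *m x^T.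
have xf : x *m f = s%:M by rewrite [LHS]mx11_scalar mulmxA.
(* This is [(W + f f^T) G^-1], because [f^T G^-1 = x]. *)
pose N := W *m invmx G + f *m x.
have NE : W + f *m f^T = N *m G.
  by rewrite mulmxDl mulmxKV // -mulmxA trmx_mul trmxK Gs.
have NN : N *m N = (- s)%:M *m (1%:M + (- ((1 + s) / s) *: f) *m x).
  rewrite mulmxDl !mulmxDr.
  have -> : W *m invmx G *m (f *m x) = 0.
    by rewrite mulmxA -(mulmxA W) mulKmx // Wx mul0mx.
  have -> : f *m x *m (W *m invmx G) = 0 by rewrite -mulmxA (mulmxA x) xW mul0mx mulmx0.
  have -> : f *m x *m (f *m x) = s *: (f *m x).
    by rewrite mulmxA -(mulmxA f) xf mul_mx_scalar scalemxAl.
  rewrite !mulmxA WW -/f addr0 add0r mulmx1 mul_scalar_mx -!scalemxAl scalerA.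
  rewrite mulrNN mulrCA mulfV // mulr1 scalerDl scale1r addrA.
  by rewrite raddfN.
(* The rank one factor of [N N] has determinant [1 - (1 + s) = - s], and [(- s)^7 (- s) = s^8]. *)
rewrite NE det_mulmx exprMn expr2 -det_mulmx NN det_mulmx det_scalar det_add1_mulmx.
congr (_ * _); rewrite det_mx11 -scalemxAr xf !mxE eqxx !mulr1n.
by field.
Qed.

End VectorProductMetric.

(** [W x] plus the square of the form dual to [x] has a determinant that scales by a
    known factor when the metric is changed; this makes the metrics proportional, and then
    equal by comparing determinants. *)
Lemma vector_product_metric_unique (R : realType) (W : 'rV[R]_7 -> 'M[R]_7) (P Q : 'M[R]_7) :
  P \in unitmx -> Q \in unitmx ->
  (forall x, x *m W x = 0) -> (forall x, W x *m x^T = 0) ->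
  (forall G, G = P *m P^T \/ G = Q *m Q^T -> forall x,
     W x *m invmx G *m W x *m invmx G = - ((x *m G *m x^T) 0 0)%:M + G *m x^T *m x) ->
  Q *m Q^T = P *m P^T.
Proof.
move=> PU QU xW Wx WW.
have normP (A : 'M[R]_7) (x : 'rV[R]_7) : (x *m (A *m A^T) *m x^T) 0 0 = \sum_c (x *m A) 0 c ^+
    2.
  rewrite mulmxA -mulmxA -trmx_mul mxE; apply: eq_bigr => c _.
  by rewrite [(x *m A)^T _ _]mxE expr2.
have norm_ge0 (A : 'M[R]_7) (x : 'rV[R]_7) : 0 <= (x *m (A *m A^T) *m x^T) 0 0.
  by rewrite normP; apply: sumr_ge0 => c _; rewrite sqr_ge0.
have norm_eq0 (A : 'M[R]_7) (x : 'rV[R]_7) : A \in unitmx -> (x *m (A *m A^T) *m x^T) 0 0 = 0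
    -> x = 0.
  move=> AU; rewrite normP => /eqP; rewrite psumr_eq0 => [/allP H|c _]; last exact: sqr_ge0.
  apply: (can_inj (mulmxK AU)); rewrite mul0mx; apply/rowP => c; rewrite [RHS]mxE.
  by have := H c (mem_index_enum _); rewrite /= sqrf_eq0 => /eqP.
have AAU (A : 'M[R]_7) : A \in unitmx -> A *m A^T \in unitmx.
  by move=> AU; rewrite unitmx_mul unitmx_tr AU.
have AAs (A : 'M[R]_7) : (A *m A^T)^T = A *m A^T by rewrite trmx_mul trmxK.
pose p : R := `|\det P|; pose q : R := `|\det Q|.
have p0 : 0 < p by rewrite normr_gt0 -unitfE -unitmxE.
have q0 : 0 < q by rewrite normr_gt0 -unitfE -unitmxE.
have sE (x : 'rV[R]_7) : q * (x *m (Q *m Q^T) *m x^T) 0 0 = p * (x *m (P *m P^T) *m x^T) 0 0.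
  have [->|x0] := eqVneq x 0; first by rewrite !mul0mx !mxE !mulr0.
  set s : R := (x *m (P *m P^T) *m x^T) 0 0; set t : R := (x *m (Q *m Q^T) *m x^T) 0 0.
  have s0 : s != 0 by apply: contra x0 => /eqP /(norm_eq0 P x PU) ->.
  have t0 : t != 0 by apply: contra x0 => /eqP /(norm_eq0 Q x QU) ->.
  have dP := det_vector_product (AAU _ PU) (AAs P) (xW x) (Wx x) s0 (WW _ (or_introl erefl) x).
  have dQ := det_vector_product (AAU _ QU) (AAs Q) (xW x) (Wx x) t0 (WW _ (or_intror erefl) x).
  have := @det_rank1_change _ _ _ (P *m P^T *m x^T) (Q *m Q^T *m x^T) (xW x) (Wx x).
  rewrite ![x *m (_ *m x^T)]mulmxA -/s -/t => /(_ s0) /(congr1 (fun z => z ^+ 2)).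
  rewrite !exprMn dP dQ -!/s -!/t !det_mulmx !det_tr -!expr2 => E.
  (* The squared rank one comparison reads [t^8 q^4 s^4 = t^4 s^8 p^4], since [\det (Q Q^T)^2 = q^4]
     and likewise for [P]; now [s^4 t^4] cancels. *)
  have {}E : (q * t) ^+ 4 = (p * s) ^+ 4.
    rewrite !exprMn /p /q -!normrX !ger0_norm ?exprn_even_ge0 //.
    apply: (@mulIf _ (s ^+ 4 * t ^+ 4)); first by rewrite mulf_neq0 // expf_neq0.
    by move: E; rewrite -!exprM /= => E; ring: E.
  by apply/eqP; rewrite -(@eqrXn2 _ 4) ?E // mulr_ge0 ?(ltW p0) ?(ltW q0) //; exact: norm_ge0.
(* Polarization passes from the quadratic forms to the symmetric matrices. *)
have QP : q *: (Q *m Q^T) = p *: (P *m P^T).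
  apply/matrixP => a b.
  pose B (G : 'M[R]_7) (x y : 'rV[R]_7) := (x *m G *m y^T) 0 0.
  have BD G x y : G^T = G -> B G (x + y) (x + y) = B G x x + 2 * B G x y + B G y y.
    move=> Gs; have D (M N : 'M[R]_1) : (M + N) 0 0 = M 0 0 + N 0 0 by rewrite mxE.
    rewrite /B linearD /= !mulmxDl !mulmxDr !D -/(B G x y).
    have -> : B G x y = B G y x.
      transitivity ((x *m G *m y^T)^T 0 0); first by rewrite mxE.
      by rewrite !trmx_mul trmxK Gs mulmxA.
    rewrite /B; ring.
  have Bdelta G : B G (delta_mx 0 a) (delta_mx 0 b) = G a b.
    by rewrite /B -rowE trmx_delta -colE !mxE.
  have := sE (delta_mx 0 a + delta_mx 0 b); rewrite -!/(B _ _ _) !BD ?AAs //.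
  have := sE (delta_mx 0 a); have := sE (delta_mx 0 b); rewrite -!/(B _ _ _) !Bdelta !mxE.
  rewrite mulrDr.
lra.
(* Determinants in dimension 7 give [q^7 q^2 = p^7 p^2]. *)
have pq : p = q.
  have := congr1 determinant QP; rewrite !detZ !det_mulmx !det_tr.
  rewrite -!expr2 -[\det Q ^+ 2]real_normK ?num_real // -[\det P ^+ 2]real_normK ?num_real //.
  by rewrite -/p -/q -!exprD => /(@expr_odd_inj _ 9 isT).
by apply: (scalerI (lt0r_neq0 q0)); rewrite QP pq.
Qed.

(** The contraction of [x] into [w], as a matrix. No metric enters, so it is common to the two
    metrics to be compared. *)
Definition form_mx (R : realType) (w : tensor R 7 3) (x : 'rV[R]_7) : 'M[R]_7 :=
  \matrix_(b, c) \sum_a x 0 a * w [tuple a; b; c].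

Lemma cross_mx (R : realType) g (w : tensor R 7 3) x y :
  cross g w x y = y *m form_mx w x *m invmx (metric_mx g).
Proof.
apply/rowP => b; rewrite /cross /sharp !mxE; apply: eq_bigr => a _; congr (_ * _).
rewrite mxE; apply: eq_bigr => e _; rewrite !mxE; congr (_ * _).
Qed.

(** On imaginary octonions [conj x (x y) = |x|^2 y] reads [x × (x × y) = - |x|^2 y + <x, y> x], and
    [y] is sent to [x × y] by [form_mx w x] times [G^-1], acting on rows. *)
Lemma left_alternative_form_mx (R : realType) (g : tensor R 7 2) (w : tensor R 7 3) (x :
    'rV[R]_7) :
  (metric_mx g)^T = metric_mx g ->
  (forall y, (oct_mul g w (oct_conj (0, x)) (oct_mul g w (0, x) (0, y))).2 = inner g x x *: y)
      ->
  form_mx w x *m invmx (metric_mx g) *m form_mx w x *m invmx (metric_mx g) =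
  - ((x *m metric_mx g *m x^T) 0 0)%:M + metric_mx g *m x^T *m x.
Proof.
set G := metric_mx g => Gs H; apply/row_matrixP => r; rewrite !rowE.
move: (delta_mx 0 r) => y.
have formN : form_mx w (- x) = - form_mx w x.
  by apply/matrixP => b c; rewrite !mxE -sumrN; apply: eq_bigr => a _; rewrite mxE mulNr.
have := H y; rewrite /= !cross_mx formN !scale0r !add0r mulr0 add0r scaleNr scalerN opprK.
rewrite mulmxN mulNmx -/G => E; rewrite mulmxDr mulmxN mul_mx_scalar !mulmxA -innerE -E.
rewrite [y *m G *m x^T]mx11_scalar mul_scalar_mx.
have -> : (y *m G *m x^T) 0 0 = inner g x y.
  rewrite innerE -/G; transitivity ((y *m G *m x^T)^T 0 0); first by rewrite [RHS]mxE.
  by rewrite !trmx_mul trmxK Gs mulmxA.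
by rewrite opprB subrK.
Qed.

Section AlternatingForm.
Variables (R : realType) (w : tensor R 7 3).
Hypothesis w_alt : alternating w.

Lemma alternating3_swap12 a b c : w [tuple a; b; c] = - w [tuple b; a; c].
Proof.
have := w_alt (tperm 0 1) [tuple b; a; c]; rewrite odd_tperm expr1 mulN1r => <-.
congr w; apply: eq_from_tnth => r; rewrite tnth_mktuple !(tnth_nth a).
case: tpermP => [->|->|] //; case: r => [[|[|[|]]]] //= ? ne0 ne1.
  by case: ne0; apply/val_inj.
by case: ne1; apply/val_inj.
Qed.

Lemma alternating3_swap13 a b c : w [tuple a; b; c] = - w [tuple c; b; a].
Proof.
have := w_alt (tperm 0 2) [tuple c; b; a]; rewrite odd_tperm expr1 mulN1r => <-.
congr w; apply: eq_from_tnth => r; rewrite tnth_mktuple !(tnth_nth a).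
case: tpermP => [->|->|] //; case: r => [[|[|[|]]]] //= ? ne0 ne1.
  by case: ne0; apply/val_inj.
by case: ne1; apply/val_inj.
Qed.

Let antisym_sum (x : 'rV[R]_7) (f : 'I_7 -> 'I_7 -> R) :
  (forall a b, f a b = - f b a) -> \sum_a \sum_b x 0 a * x 0 b * f a b = 0.
Proof.
move=> fN; set S := \sum_a _; have : S = - S.
  rewrite -sumrN {1}/S exchange_big; apply: eq_bigr => a _; rewrite -sumrN.
  by apply: eq_bigr => b _; rewrite fN; ring.
lra.
Qed.

Lemma mul_form_mx x : x *m form_mx w x = 0.
Proof.
apply/rowP => c; rewrite !mxE -[RHS](@antisym_sum x (fun a b => w [tuple a; b; c]) (fun a b =>
    alternating3_swap12 a b c)) [RHS]exchange_big /=.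
apply: eq_bigr => b _; rewrite mxE mulr_sumr; apply: eq_bigr => a _.
ring.
Qed.

Lemma form_mx_mul x : form_mx w x *m x^T = 0.
Proof.
apply/colP => b; rewrite !mxE -[RHS](@antisym_sum x (fun a c => w [tuple a; b; c]) (fun a c =>
    alternating3_swap13 a b c)).
rewrite exchange_big; apply: eq_bigr => c _; rewrite !mxE mulr_suml; apply: eq_bigr => a _;
    ring.
Qed.

End AlternatingForm.

Section Sigma.
Variables (R : realType) (M : manifold R 7) (phi phit : G2_structure M).
Variable V : field M (octonion R).
Hypothesis V_unit : unit_section phi V.
Hypothesis phit_sigma : forall i p, dom i p -> G2_form phit i p =1 sigma phi V i p.

Lemma twisted_mul_sigma i p A B : dom i p ->
  let mul := oct_mul (metric phi i p) (G2_form phi i p) in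
  oct_mul (metric phi i p) (G2_form phit i p) A B =
  mul (mul A (mul B (V i p))) (inv_section phi V i p).
Proof.
move=> ip; have [P [PU phiP gP psiP]] := G2_frame phi ip.
apply: (twisted_mul PU gP phiP psiP); first exact: V_unit.2.
by move=> I; rewrite phit_sigma.
Qed.

(** Both metrics satisfy [conj x (x y) = |x|^2 y] for the product they build from the form of
    [phit]: its own metric as that of a G2-structure, the metric of [phi] because in the twisted
    product the inner [V^-1] and [V] cancel, leaving [(conj x (x (y V))) V^-1]. *)
Lemma metric_sigma i p : dom i p -> metric phit i p =1 metric phi i p.
Proof.
move=> ip; have [P [PU phiP gP psiP]] := G2_frame phi ip.
have [Q [QU phitQ gQ _]] := G2_frame phit ip.
have V1 := V_unit.2 _ _ ip.
have walt := (G2_form_diff_form phit).2 _ _ ip.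
suff E : metric_mx (metric phit i p) = metric_mx (metric phi i p).
  move=> I; have -> : I = [tuple tnth I 0; tnth I 1].
    by apply: eq_from_tnth => r; rewrite [RHS](tnth_nth (tnth I 0)); case: r => [[|[|]]] //= ?;
       congr tnth; apply/val_inj.
  by move/matrixP: E => /(_ (tnth I 0) (tnth I 1)); rewrite !mxE.
rewrite gP gQ; apply: (vector_product_metric_unique (W := form_mx (G2_form phit i p)) PU QU).
- by move=> x; apply: mul_form_mx.
- by move=> x; apply: form_mx_mul.
move=> _ [] -> x.
- rewrite -gP; apply: left_alternative_form_mx; first by rewrite gP trmx_mul trmxK.
  move=> y; rewrite !twisted_mul_sigma //.
  rewrite /inv_section (oct_mulVK PU gP phiP V1) (oct_mul_conjK PU gP phiP).
  rewrite (oct_mulZl PU gP phiP) (oct_mulK PU gP phiP V1) /=.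
  by rewrite /oct_inner /= mul0r add0r.
- rewrite -gQ; apply: left_alternative_form_mx; first by rewrite gQ trmx_mul trmxK.
  move=> y; rewrite (oct_mul_conjK QU gQ phitQ) /=.
  by rewrite /oct_inner /= mul0r add0r.
Qed.

End Sigma.

(** * Leibniz rules *)

Section DirectionalDerivative.
Variables (R : realType) (M : manifold R 7) (i : chart M) (p : M).
Hypothesis ip : dom i p.
Variable X : 'rV[R]_7.

(** Relational, so that existence and value of derivatives are proved together. *)
Definition has_dir (f : M -> R) (l : R) : Prop :=
  (forall a, derivable (f \o param i) (coord i p) (delta_mx 0 a)) /\
  \sum_a X 0 a * pd i a f p = l.

Lemma near_dom : nbhs (coord i p) (param i @^-1` dom i).
Proof.
apply: (param_continuous ip); rewrite coordK //.
exact: open_nbhs_nbhs (conj (@dom_open _ _ _ i) ip).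
Qed.

Lemma has_dir_near f h l : (forall q, dom i q -> f q = h q) -> has_dir f l -> has_dir h l.
Proof.
move=> fh [fd <-].
have H : {near coord i p, f \o param i =1 h \o param i}.
  by apply: filterS near_dom => x /= /fh.
split=> [a|]; first exact: near_eq_derivable (fd a).
apply: eq_bigr => a _; congr (_ * _); apply/esym; exact: near_eq_derive.
Qed.

Lemma has_dir_unique f l l' : has_dir f l -> has_dir f l' -> l = l'.
Proof. by move=> [_ <-] [_ <-]. Qed.

Lemma has_dir_cst k : has_dir (fun=> k) 0.
Proof.
split=> [a|]; first exact: derivable_cst.
by apply: big1 => a _; have -> : pd i a (fun=> k) p = 0 by [exact: derive_cst]; rewrite mulr0.
Qed.

Lemma has_dirD f h l m : has_dir f l -> has_dir h m -> has_dir (fun q => f q + h q) (l + m).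
Proof.
move=> [fd <-] [hd <-]; split=> [a|]; first exact: derivableD (fd a) (hd a).
rewrite -big_split; apply: eq_bigr => a _ /=; rewrite -mulrDr; congr (_ * _).
exact: deriveD (fd a) (hd a).
Qed.

Lemma has_dirN f l : has_dir f l -> has_dir (fun q => - f q) (- l).
Proof.
move=> [fd <-]; split=> [a|]; first exact: derivableN (fd a).
rewrite -sumrN; apply: eq_bigr => a _ /=; rewrite -mulrN; congr (_ * _).
exact: deriveN (fd a).
Qed.

Lemma has_dirM f h l m :
  has_dir f l -> has_dir h m -> has_dir (fun q => f q * h q) (l * h p + f p * m).
Proof.
move=> [fd <-] [hd <-]; split=> [a|]; first exact: derivableM (fd a) (hd a).
rewrite mulr_suml mulr_sumr -big_split; apply: eq_bigr => a _ /=.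
rewrite /pd [X in 'D_ _ X _](_ : _ = (f \o param i) * (h \o param i)) //.
rewrite deriveM //= coordK // /GRing.scale /=; ring.
Qed.

Lemma has_dir_sum (I : Type) (r : seq I) (f : I -> M -> R) (l : I -> R) :
  (forall k, has_dir (f k) (l k)) -> has_dir (fun q => \sum_(k <- r) f k q) (\sum_(k <- r) l k).
Proof.
move=> fl; elim: r => [|k r IH].
  by rewrite big_nil; apply: (@has_dir_near (fun=> 0)); [move=> q _; rewrite big_nil|exact:
      has_dir_cst].
rewrite big_cons; apply: (@has_dir_near (fun q => f k q + \sum_(k <- r) f k q)).
  by move=> q _; rewrite big_cons.
exact: has_dirD.
Qed.

Lemma derivable_has_dir f :
  (forall a, derivable (f \o param i) (coord i p) (delta_mx 0 a)) ->
  has_dir f (\sum_a X 0 a * pd i a f p).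
Proof. by []. Qed.

Lemma smooth_has_dir f : smooth_in i f -> exists l, has_dir f l.
Proof.
move=> /(_ 1%N) [fd _]; exists (\sum_a X 0 a * pd i a f p); split=> // a.
by apply/diff_derivable/fd; exists p.
Qed.

Definition differentiable_dir f := exists l, has_dir f l.

Lemma differentiable_dir_prod (I : Type) (r : seq I) (f : I -> M -> R) :
  (forall k, differentiable_dir (f k)) -> differentiable_dir (fun q => \prod_(k <- r) f k q).
Proof.
move=> fl; elim: r => [|k r [l IH]].
  by exists 0; apply: (@has_dir_near (fun=> 1)); [move=> q _; rewrite big_nil|exact:
      has_dir_cst].
have [m fk] := fl k; exists (m * (\prod_(k <- r) f k p) + f k p * l).
apply: (@has_dir_near (fun q => f k q * \prod_(k <- r) f k q)).
  by move=> q _; rewrite big_cons.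
exact: has_dirM.
Qed.

Lemma differentiable_dir_sum (I : finType) (f : I -> M -> R) :
  (forall k, differentiable_dir (f k)) -> differentiable_dir (fun q => \sum_k f k q).
Proof.
move=> /(_ _)/cid fl; exists (\sum_k sval (fl k)); apply: has_dir_sum => k.
exact: svalP (fl k).
Qed.

Lemma differentiable_dirM f h :
  differentiable_dir f -> differentiable_dir h -> differentiable_dir (fun q => f q * h q).
Proof. by move=> [l fl] [m hm]; eexists; apply: has_dirM fl hm. Qed.

Lemma differentiable_dir_cst k : differentiable_dir (fun=> k).
Proof. exists 0; exact: has_dir_cst. Qed.

Lemma differentiable_dir_near f h :
  (forall q, dom i q -> f q = h q) -> differentiable_dir f -> differentiable_dir h.
Proof. by move=> fh [l fl]; exists l; apply: has_dir_near fl. Qed.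

Lemma differentiable_dir_det n (A : M -> 'M[R]_n) :
  (forall a b, differentiable_dir (fun q => A q a b)) -> differentiable_dir (fun q => \det (A
      q)).
Proof.
move=> Ad; apply: differentiable_dir_sum => s; apply: differentiable_dirM.
  exact: differentiable_dir_cst.
exact: differentiable_dir_prod.
Qed.

Lemma differentiable_dirV f : f p != 0 -> differentiable_dir f -> differentiable_dir (fun q =>
    (f q)^-1).
Proof.
move=> f0 [l [fd _]]; eexists; apply: derivable_has_dir => a.
by apply: derivableV (fd a); rewrite /= coordK.
Qed.

Lemma differentiable_dir_invmx n (A : M -> 'M[R]_n) a b :
  (forall q, dom i q -> A q \in unitmx) ->
  (forall a b, differentiable_dir (fun q => A q a b)) ->
  differentiable_dir (fun q => invmx (A q) a b).
Proof.
move=> AU Ad; apply: (@differentiable_dir_near (fun q => (\det (A q))^-1 * cofactor (A q) b a)).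
  by move=> q iq; rewrite /invmx AU // !mxE.
apply: differentiable_dirM.
  apply: differentiable_dirV; last exact: differentiable_dir_det.
  by rewrite -unitfE -unitmxE AU.
apply: differentiable_dirM; first exact: differentiable_dir_cst.
apply: differentiable_dir_det => c d.
by apply: differentiable_dir_near (Ad (lift b c) (lift a d)) => q _; rewrite !mxE.
Qed.

Definition has_dir_oct (A : M -> octonion R) (l : octonion R) : Prop :=
  has_dir (fun q => (A q).1) l.1 /\ forall b, has_dir (fun q => (A q).2 0 b) (l.2 0 b).

Lemma has_dir_oct_near A B l :
  (forall q, dom i q -> A q = B q) -> has_dir_oct A l -> has_dir_oct B l.
Proof.
move=> AB [A1 A2]; split=> [|b]; first by apply: has_dir_near A1 => q /AB->.
by apply: has_dir_near (A2 b) => q /AB->.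
Qed.

Lemma octonion_section_has_dir (A : field M (octonion R)) :
  octonion_section A -> exists l, has_dir_oct (A i) l.
Proof.
move=> [A1 _ [A2 _]]; have [l1 H1] := smooth_has_dir (A1 i).
have /(_ _)/cid H2 b := smooth_has_dir (A2 i b).
by exists (l1, \row_b sval (H2 b)); split=> // b; rewrite mxE; apply: svalP (H2 b).
Qed.

Section Connection.
Variable g : field M (tensor R 7 2).
Hypothesis gR : riemannian_metric g.

(** The connection form of [g] evaluated on [X]; vectors are rows, so it acts from the right. *)
Definition connection_mx : 'M[R]_7 :=
  \matrix_(c, b) \sum_a X 0 a * christoffel g i p b a c.

(** [fun=> A] uses one component function for all charts: the derivative in chart [i] sees only the
    components in that chart. *)
Lemma nabla_octonionE (A : M -> octonion R) l : has_dir_oct A l ->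
  nabla_octonion g (fun=> A) i p X = l + (0, (A p).2 *m connection_mx).
Proof.
move=> [[_ A1] A2]; rewrite [RHS]surjective_pairing /=; congr pair; first by rewrite addr0.
apply/rowP => b; rewrite !mxE -(A2 b).2.
under eq_bigr do rewrite mulrDr.
rewrite big_split /=; congr (_ + _); under eq_bigr do rewrite mulr_sumr.
rewrite exchange_big; apply: eq_bigr => c _; rewrite mxE mulr_sumr.
by apply: eq_bigr => a _; ring.
Qed.

(** Metric compatibility of the Levi-Civita connection, solved for the plain derivative. *)
Lemma has_dir_metric b c : has_dir (fun q => metric_mx (g i q) b c)
  ((connection_mx *m metric_mx (g i p) + metric_mx (g i p) *m connection_mx^T) b c).
Proof.
have [[gs _] _ _] := gR; have [_ [gd _]] := smooth_has_dir (gs i [tuple b; c]).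
apply: (@has_dir_near (fun q => g i q [tuple b; c])) => [q _|]; first by rewrite mxE.
split=> //; have [_ /(_ (fun _ _ _ => erefl)) [_ gm]] := christoffelP (christoffel g i p) gR ip.
under eq_bigr do rewrite gm mulrDr.
rewrite big_split !mxE /=; congr (_ + _); under eq_bigr do rewrite mulr_sumr.
  rewrite exchange_big; apply: eq_bigr => m _; rewrite !mxE mulr_suml.
  by apply: eq_bigr => a _; ring.
rewrite exchange_big; apply: eq_bigr => m _; rewrite !mxE mulr_sumr.
by apply: eq_bigr => a _; ring.
Qed.

End Connection.
End DirectionalDerivative.

(** * Derivative of the cross product *)

Section Leibniz.
Variables (R : realType) (M : manifold R 7) (S : G2_structure M).
Variable T : field M (tensor R 7 2).
Hypothesis hT : is_torsion S T.
Variables (i : chart M) (p : M).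
Hypothesis ip : dom i p.
Variable X : 'rV[R]_7.

Local Notation g q := (metric S i q).
Local Notation phi q := (G2_form S i q).
Local Notation Gamma := (connection_mx i p X (metric S)).
Local Notation nabla A := (nabla_octonion (metric S) (fun=> A) i p X).
Local Notation tau := (torsion_vector (metric S i p) (T i p) X).

Lemma torsion_vector_linear :
  tau = \sum_a X 0 a *: torsion_vector (g p) (T i p) (delta_mx 0 a).
Proof.
apply/rowP => e; rewrite summxE !mxE; under [RHS]eq_bigr do rewrite !mxE mulr_sumr.
rewrite exchange_big; apply: eq_bigr => b _ /=; rewrite /contract mulr_suml.
have D (a c : 'I_7) : (delta_mx 0 a : 'rV[R]_7) 0 c = (c == a)%:R by rewrite mxE.
apply: eq_bigr => a _; rewrite (bigD1 a) //= D (eqxx a) mul1r big1 ?addr0 ?mulrA //.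
by move=> c /negbTE ca; rewrite D ca mul0r.
Qed.

Lemma set_index3 (b c d m : 'I_7) :
  [/\ set_index [tuple b; c; d] 0 m = [tuple m; c; d],
      set_index [tuple b; c; d] 1 m = [tuple b; m; d]
    & set_index [tuple b; c; d] 2 m = [tuple b; c; m]].
Proof.
by split; apply: eq_from_tnth => r; rewrite tnth_mktuple !(tnth_nth b); case: r => [[|[|[|]]]].
Qed.

(** The torsion equation solved for the plain derivative; the three [Gamma] terms are the
    Christoffel corrections of the three slots. *)
Lemma has_dir_G2_form b c d : has_dir i p X (fun q => phi q [tuple b; c; d])
  (\sum_m (Gamma b m * phi p [tuple m; c; d] + Gamma c m * phi p [tuple b; m; d]
           + Gamma d m * phi p [tuple b; c; m])
   + 2 * \sum_e tau 0 e * dual_form S i p [tuple e; b; c; d]).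
Proof.
have [[phis _] _] := G2_form_diff_form S.
have [_ [fd _]] := smooth_has_dir ip X (phis i [tuple b; c; d]); split=> //.
have E a := hT.2 _ _ ip a b c d.
transitivity (\sum_a X 0 a * (\sum_(r < 3) \sum_m christoffel (metric S) i p m a (tnth [tuple
    b; c; d] r)
      * phi p (set_index [tuple b; c; d] r m) +
   2 * \sum_e torsion_vector (g p) (T i p) (delta_mx 0 a) 0 e * dual_form S i p [tuple e; b; c;
       d])).
  by apply: eq_bigr => a _; rewrite -E /nabla_tensor addrC subrK.
under eq_bigr do rewrite mulrDr; rewrite big_split /=; congr (_ + _).
  have sum3 (F : 'I_3 -> R) : \sum_r F r = F 0 + F 1 + F 2.
    rewrite !big_ord_recl big_ord0 addr0 addrA; congr (_ + F _ + F _); exact/val_inj.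
  under eq_bigr do rewrite sum3 -!big_split mulr_sumr /=.
  rewrite exchange_big; apply: eq_bigr => m _ /=.
  have [s0 s1 s2] := set_index3 b c d m.
  rewrite !mxE !mulr_suml -!big_split; apply: eq_bigr => a _ /=.
  rewrite s0 s1 s2 !(tnth_nth b) /=; ring.
rewrite torsion_vector_linear; under eq_bigr do rewrite mulrCA mulr_sumr.
rewrite -mulr_sumr exchange_big; congr (_ * _); apply: eq_bigr => e _ /=.
have scale_e k (v : 'rV[R]_7) : (k *: v) 0 e = k * v 0 e by rewrite mxE.
rewrite summxE mulr_suml; apply: eq_bigr => a _; rewrite scale_e; ring.
Qed.

Lemma teval4_delta (w : tensor R 7 4) (t x y : 'rV[R]_7) d :
  teval w [tuple t; x; y; delta_mx 0 d] =
  \sum_b \sum_c x 0 b * y 0 c * \sum_e t 0 e * w [tuple e; b; c; d].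
Proof.
transitivity (\sum_e \sum_b \sum_c \sum_f
    t 0 e * (x 0 b * (y 0 c * (f == d)%:R)) * w [tuple e; b; c; f]).
  rewrite /teval sum_tuple_cons; apply: eq_bigr => e _; rewrite sum_tuple_cons.
  apply: eq_bigr => b _; rewrite sum_tuple_cons; apply: eq_bigr => c _; rewrite sum_tuple_cons.
  apply: eq_bigr => f _; rewrite sum_tuple0 !big_ord_recl big_ord0 mulr1.
  congr (_ * (_ * (_ * _)) * w _).
  by rewrite !(tnth_nth 0) mxE.
rewrite exchange_big; apply: eq_bigr => b _; rewrite exchange_big; apply: eq_bigr => c _ /=.
rewrite mulr_sumr; apply: eq_bigr => e _; rewrite (bigD1 d) //= eqxx big1 ?addr0.
  by rewrite mulr1; ring.
by move=> f /negbTE->; rewrite !mulr0 mul0r.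
Qed.

Lemma sum_torsion_assoc (P : 'M[R]_7) (alpha beta : 'rV[R]_7) :
  P \in unitmx -> phi p =1 pullback P (@phi0 R) -> metric_mx (g p) = P *m P^T ->
  dual_form S i p =1 pullback P (psi0 R) ->
  \row_d \sum_b \sum_c alpha 0 b * beta 0 c *
    (2 * \sum_e tau 0 e * dual_form S i p [tuple e; b; c; d]) =
  (oct_assoc (g p) (phi p) (0, tau) (0, alpha) (0, beta)).2 *m metric_mx (g p).
Proof.
move=> PU phiP gP psiP; apply/rowP => d; rewrite mxE.
transitivity (inner (g p) (oct_assoc (g p) (phi p) (0, tau) (0, alpha) (0, beta)).2 (delta_mx 0
    d)).
  rewrite -(teval_psi_assoc PU gP phiP psiP).
  rewrite teval4_delta mulr_sumr; apply: eq_bigr => b _.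
  by rewrite mulr_sumr; apply: eq_bigr => c _; rewrite mulrCA.
by rewrite innerE trmx_delta -colE 2!mxE.
Qed.

(** Lowering the index of the cross product gives [w], trilinear in [A], [B] and [phi]. The
    derivative of [w] is computed once through the metric and once through [phi], and the two values
    are equated. [l] stays existential, as the equation for its covariant correction is what is
    wanted. *)
Lemma has_dir_cross (A B : M -> octonion R) lA lB :
  has_dir_oct i p X A lA -> has_dir_oct i p X B lB ->
  exists l : 'rV[R]_7,
    (forall d, has_dir i p X (fun q => cross (g q) (phi q) (A q).2 (B q).2 0 d) (l 0 d)) /\
    l + cross (g p) (phi p) (A p).2 (B p).2 *m Gamma =
    cross (g p) (phi p) (lA.2 + (A p).2 *m Gamma) (B p).2
    + cross (g p) (phi p) (A p).2 (lB.2 + (B p).2 *m Gamma)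
    + (oct_assoc (g p) (phi p) (0, tau) (0, (A p).2) (0, (B p).2)).2.
Proof.
move=> [_ hA] [_ hB].
have gR := metric_riemannian S.
have formE (w : tensor R 7 3) (x y : 'rV[R]_7) d :
    (y *m form_mx w x) 0 d = \sum_b \sum_c x 0 b * y 0 c * w [tuple b; c; d].
  rewrite mxE exchange_big; apply: eq_bigr => c _; rewrite mxE mulr_sumr.
  by apply: eq_bigr => b _; ring.
pose w q : 'rV[R]_7 := (B q).2 *m form_mx (phi q) (A q).2.
have wE q d : w q 0 d = \sum_b \sum_c (A q).2 0 b * (B q).2 0 c * phi q [tuple b; c; d].
  exact: formE.
pose gam q := cross (g q) (phi q) (A q).2 (B q).2.
have gamE q d : dom i q -> \sum_m gam q 0 m * metric_mx (g q) m d = w q 0 d.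
  move=> iq; transitivity ((gam q *m metric_mx (g q)) 0 d); first by rewrite [RHS]mxE.
  by rewrite /gam cross_mx (mulmxKV (metric_mx_unit gR iq)).
have wd d : differentiable_dir i p X (fun q => w q 0 d).
  apply: (@differentiable_dir_near _ _ _ _ ip X (fun q => \sum_b \sum_c (A q).2 0 b * (B q).2 0
      c * phi q [tuple b; c; d])).
    by move=> q _; rewrite wE.
  apply: (differentiable_dir_sum ip) => b; apply: (differentiable_dir_sum ip) => c.
  apply: (differentiable_dirM ip); last by eexists; apply: has_dir_G2_form.
  by apply: (differentiable_dirM ip); eexists; [apply: hA|apply: hB].
(* The inverse metric is differentiated only here, and only for existence; the value comes from
   comparing [E1] with [E2]. *)
have gamd d : differentiable_dir i p X (fun q => gam q 0 d).
  apply: (@differentiable_dir_near _ _ _ _ ip X (fun q => \sum_m w q 0 m * invmx (metric_mx (g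
      q)) m d)).
    by move=> q _; rewrite /gam cross_mx [RHS]mxE.
  apply: (differentiable_dir_sum ip) => m; apply: (differentiable_dirM ip) => //.
  apply: (differentiable_dir_invmx ip) => [q iq|b c]; first exact: metric_mx_unit gR iq.
  by eexists; apply: (has_dir_metric ip).
have /(_ _)/cid gamd' := gamd.
pose l := \row_d sval (gamd' d).
have gaml d : has_dir i p X (fun q => gam q 0 d) (l 0 d) by rewrite mxE; apply: svalP (gamd' d).
exists l; split=> //.
have [P [PU phiP gP psiP]] := G2_frame S ip.
have gU := metric_mx_unit gR ip.
apply: (can_inj (mulmxK gU)).
rewrite 3!mulmxDl -(sum_torsion_assoc _ _ PU phiP gP psiP) !cross_mx !(mulmxKV gU).
rewrite -cross_mx -/(gam p).
apply/rowP => d.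
have E1 : has_dir i p X (fun q => w q 0 d) (\sum_m (l 0 m * metric_mx (g p) m d + gam p 0 m *
    (Gamma *m metric_mx (g p) + metric_mx (g p) *m Gamma^T) m d)).
  apply: (@has_dir_near _ _ _ _ ip X (fun q => \sum_m gam q 0 m * metric_mx (g q) m d)).
    by move=> q iq; rewrite gamE.
  apply: (has_dir_sum ip) => m; apply: (has_dirM ip) => //; exact: has_dir_metric.
have E2 : has_dir i p X (fun q => w q 0 d) (\sum_b \sum_c (
    (lA.2 0 b * (B p).2 0 c + (A p).2 0 b * lB.2 0 c) * phi p [tuple b; c; d]
    + (A p).2 0 b * (B p).2 0 c * (\sum_m (Gamma b m * phi p [tuple m; c; d] + Gamma c m * phi
        p [tuple b; m; d]
           + Gamma d m * phi p [tuple b; c; m])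
   + 2 * \sum_e tau 0 e * dual_form S i p [tuple e; b; c; d]))).
  apply: (@has_dir_near _ _ _ _ ip X (fun q => \sum_b \sum_c (A q).2 0 b * (B q).2 0 c * phi q
      [tuple b; c; d])).
    by move=> q _; rewrite wE.
  apply: (has_dir_sum ip) => b; apply: (has_dir_sum ip) => c.
  apply: (has_dirM ip); last exact: has_dir_G2_form.
  apply: (has_dirM ip) => //.
have := has_dir_unique E1 E2; rewrite big_split /= => {E1 E2} E.
have {}E : (l *m metric_mx (g p)) 0 d + (gam p *m Gamma *m metric_mx (g p)) 0 d + \sum_m w p 0
    m * Gamma d m
   = \sum_b \sum_c (
    (lA.2 0 b * (B p).2 0 c + (A p).2 0 b * lB.2 0 c) * phi p [tuple b; c; d]
    + (A p).2 0 b * (B p).2 0 c * (\sum_m (Gamma b m * phi p [tuple m; c; d] + Gamma c m * phi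
        p [tuple b; m; d]
           + Gamma d m * phi p [tuple b; c; m])
   + 2 * \sum_e tau 0 e * dual_form S i p [tuple e; b; c; d])).
  rewrite -E -addrA; congr (_ + _); first by rewrite mxE.
  have -> : \sum_m w p 0 m * Gamma d m = (gam p *m metric_mx (g p) *m Gamma^T) 0 d.
    rewrite [RHS]mxE; apply: eq_bigr => m _; rewrite [X in _ = X * _]mxE gamE //.
    by rewrite [Gamma^T m d]mxE.
  transitivity ((gam p *m (Gamma *m metric_mx (g p) + metric_mx (g p) *m Gamma^T)) 0 d).
    by rewrite mulmxDr !mulmxA [RHS]mxE.
  by rewrite mxE.
(* The term [w Gamma^T], produced by lowering the index, matches the [Gamma] correction in the last
   slot of [phi]; the corrections of the other two slots complete the covariant derivatives of [A]
   and [B]. *)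
rewrite mxE; apply: (addIr (\sum_m w p 0 m * Gamma d m)); rewrite {}E.
rewrite 2!mxE !formE mxE.
pose a := (A p).2; pose b' := (B p).2.
have H1 : \sum_b \sum_c (lA.2 + a *m Gamma) 0 b * b' 0 c * phi p [tuple b; c; d] =
   \sum_b \sum_c (lA.2 0 b * b' 0 c * phi p [tuple b; c; d]
      + a 0 b * b' 0 c * \sum_m Gamma b m * phi p [tuple m; c; d]).
  transitivity (\sum_b \sum_c lA.2 0 b * b' 0 c * phi p [tuple b; c; d] +
     \sum_b \sum_c \sum_m a 0 m * Gamma m b * b' 0 c * phi p [tuple b; c; d]).
    rewrite -big_split; apply: eq_bigr => b _; rewrite -big_split; apply: eq_bigr => c _ /=.
    rewrite [(lA.2 + _) 0 b]mxE [(a *m Gamma) 0 b]mxE !mulrDl; congr (_ + _).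
    by rewrite !mulr_suml.
  under [RHS]eq_bigr do rewrite big_split; rewrite [RHS]big_split; congr (_ + _) => /=.
  under eq_bigr do rewrite exchange_big; rewrite exchange_big; apply: eq_bigr => m _ /=.
  rewrite exchange_big; apply: eq_bigr => c _; rewrite mulr_sumr; apply: eq_bigr => b _; ring.
have H2 : \sum_b \sum_c a 0 b * (lB.2 + b' *m Gamma) 0 c * phi p [tuple b; c; d] =
   \sum_b \sum_c (a 0 b * lB.2 0 c * phi p [tuple b; c; d]
      + a 0 b * b' 0 c * \sum_m Gamma c m * phi p [tuple b; m; d]).
  apply: eq_bigr => b _.
  transitivity (\sum_c a 0 b * lB.2 0 c * phi p [tuple b; c; d] +
     \sum_c \sum_m a 0 b * (b' 0 m * Gamma m c) * phi p [tuple b; c; d]).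
    rewrite -big_split; apply: eq_bigr => c _ /=.
    rewrite [(lB.2 + _) 0 c]mxE [(b' *m Gamma) 0 c]mxE mulrDr mulrDl; congr (_ + _).
    by rewrite mulr_sumr mulr_suml.
  rewrite [RHS]big_split; congr (_ + _) => /=; rewrite exchange_big; apply: eq_bigr => m _.
  rewrite mulr_sumr; apply: eq_bigr => c _; ring.
have H3 : \sum_m w p 0 m * Gamma d m =
   \sum_b \sum_c a 0 b * b' 0 c * \sum_m Gamma d m * phi p [tuple b; c; m].
  under eq_bigr do rewrite wE mulr_suml; rewrite exchange_big; apply: eq_bigr => b _ /=.
  under eq_bigr do rewrite mulr_suml; rewrite exchange_big; apply: eq_bigr => c _ /=.
  rewrite mulr_sumr; apply: eq_bigr => m _; rewrite -/a -/b'; ring.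
rewrite H1 H2 H3 -!big_split; apply: eq_bigr => b _; rewrite -!big_split; apply: eq_bigr => c _
    /=.
rewrite !big_split /= -/a -/b'; ring.
Qed.
End Leibniz.

Section LeibnizMul.
Variables (R : realType) (M : manifold R 7) (S : G2_structure M).
Variable T : field M (tensor R 7 2).
Hypothesis hT : is_torsion S T.
Variables (i : chart M) (p : M).
Hypothesis ip : dom i p.
Variable X : 'rV[R]_7.

Local Notation g q := (metric S i q).
Local Notation phi q := (G2_form S i q).
Local Notation Gamma := (connection_mx i p X (metric S)).
Local Notation nabla A := (nabla_octonion (metric S) (fun=> A) i p X).
Local Notation tau := (torsion_vector (metric S i p) (T i p) X).

Lemma has_dir_inner (x y : M -> 'rV[R]_7) (lx ly : 'rV[R]_7) :
  (forall d, has_dir i p X (fun q => x q 0 d) (lx 0 d)) ->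
  (forall d, has_dir i p X (fun q => y q 0 d) (ly 0 d)) ->
  has_dir i p X (fun q => inner (g q) (x q) (y q))
    (inner (g p) (lx + x p *m Gamma) (y p) + inner (g p) (x p) (ly + y p *m Gamma)).
Proof.
move=> hx hy; have gR := metric_riemannian S.
have bilE (u v : 'rV[R]_7) (N : 'M[R]_7) :
    (u *m N *m v^T) 0 0 = \sum_b \sum_c u 0 b * v 0 c * N b c.
  rewrite mxE exchange_big; apply: eq_bigr => c _; rewrite [v^T _ _]mxE mxE mulr_suml.
  by apply: eq_bigr => b _; ring.
set L := _ + _; have -> : L = \sum_b \sum_c ((lx 0 b * y p 0 c + x p 0 b * ly 0 c) * metric_mx
    (g p) b c
   + x p 0 b * y p 0 c * (Gamma *m metric_mx (g p) + metric_mx (g p) *m Gamma^T) b c).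
  transitivity ((lx *m metric_mx (g p) *m (y p)^T) 0 0 + (x p *m metric_mx (g p) *m ly^T) 0 0 +
     (x p *m (Gamma *m metric_mx (g p) + metric_mx (g p) *m Gamma^T) *m (y p)^T) 0 0).
    have D (N N' : 'M[R]_1) : (N + N') 0 0 = N 0 0 + N' 0 0 by rewrite mxE.
    rewrite /L !innerE [(ly + _)^T]linearD /= trmx_mul !mulmxDl !mulmxDr !mulmxDl !D !mulmxA.
    by rewrite addrACA.
  rewrite !bilE -!big_split; apply: eq_bigr => b _; rewrite -!big_split; apply: eq_bigr => c _
      /=.
  ring.
apply: (@has_dir_near _ _ _ _ ip X (fun q => \sum_b \sum_c x q 0 b * y q 0 c * metric_mx (g q)
    b c)).
  by move=> q _; rewrite innerE bilE.
apply: (has_dir_sum ip) => b; apply: (has_dir_sum ip) => c.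
apply: (has_dirM ip); last exact: has_dir_metric.
exact: has_dirM.
Qed.

(** The scalar product differentiates by metric compatibility, and the associator comes from the
    cross product alone. It vanishes on real arguments, so there imaginary parts may be replaced by
    [A] and [B]. *)
Lemma nabla_mul (A B : M -> octonion R) lA lB :
  has_dir_oct i p X A lA -> has_dir_oct i p X B lB ->
  let C q := oct_mul (g q) (phi q) (A q) (B q) in
  (exists l, has_dir_oct i p X C l) /\
  nabla C = oct_mul (g p) (phi p) (nabla A) (B p) + oct_mul (g p) (phi p) (A p) (nabla B)
            + oct_assoc (g p) (phi p) (0, tau) (A p) (B p).
Proof.
move=> hA hB; have [P [PU phiP gP psiP]] := G2_frame S ip.
have [l [hl lE]] := has_dir_cross hT ip hA hB.
have [[A1 A2] [B1 B2]] := (hA, hB).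
pose lC : octonion R := (lA.1 * (B p).1 + (A p).1 * lB.1 -
   (inner (g p) (lA.2 + (A p).2 *m Gamma) (B p).2 + inner (g p) (A p).2 (lB.2 + (B p).2 *m
       Gamma)),
   (lA.1 *: (B p).2 + (A p).1 *: lB.2) + (lB.1 *: (A p).2 + (B p).1 *: lA.2) + l).
have hC : has_dir_oct i p X (fun q => oct_mul (g q) (phi q) (A q) (B q)) lC.
  split=> [|d].
    apply: (has_dirD (has_dirM ip A1 B1)); apply: has_dirN; exact: has_dir_inner.
  apply: (@has_dir_near _ _ _ _ ip X (fun q => (A q).1 * (B q).2 0 d + (B q).1 * (A q).2 0 d
    + cross (g q) (phi q) (A q).2 (B q).2 0 d)).
    by move=> q _; rewrite [RHS]mxE [X in _ = X + _]mxE; congr (_ + _ + _); rewrite mxE.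
  have -> : lC.2 0 d = lA.1 * (B p).2 0 d + (A p).1 * lB.2 0 d +
      (lB.1 * (A p).2 0 d + (B p).1 * lA.2 0 d) + l 0 d.
    by rewrite !mxE.
  by apply: has_dirD => //; apply: has_dirD; apply: has_dirM.
split; first by exists lC.
rewrite (nabla_octonionE _ hC) (nabla_octonionE _ hA) (nabla_octonionE _ hB).
rewrite (oct_assoc_im PU gP phiP).
have := re_oct_assoc PU gP phiP (0, tau) (0, (A p).2) (0, (B p).2).
move: (oct_assoc _ _ (0, tau) (0, (A p).2) (0, (B p).2)) lE => [k v] /= lE ->.
congr pair => /=; first by rewrite !addr0; ring.
rewrite !mulmxDl -!scalemxAl !addr0.
transitivity (lA.1 *: (B p).2 + (A p).1 *: lB.2 + (lB.1 *: (A p).2 + (B p).1 *: lA.2)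
  + ((A p).1 *: ((B p).2 *m Gamma) + (B p).1 *: ((A p).2 *m Gamma))
  + (l + cross (g p) (phi p) (A p).2 (B p).2 *m Gamma)).
  by rewrite addrACA.
rewrite lE !scalerDr !addrA; congr (_ + _).
apply/rowP => d; rewrite ![(_ + _ : 'rV_7) _ _]mxE ![(_ *: _ : 'rV_7) _ _]mxE; ring.
Qed.

End LeibnizMul.

(** * Transformation of the torsion *)

Lemma eq_christoffel (R : realType) (M : manifold R 7) (g h : field M (tensor R 7 2)) i p c a b
    :
  (forall q, dom i q -> g i q =1 h i q) -> dom i p ->
  christoffel g i p c a b = christoffel h i p c a b.
Proof.
move=> gh ip; have pdE d I : pd i d (fun q => g i q I) p = pd i d (fun q => h i q I) p.
  apply: near_eq_derive; apply: filterS (near_dom ip) => x /= ix; exact: gh.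
congr (_ * _); apply: eq_bigr => d _; rewrite !pdE; congr (invmx _ _ _ * _).
by apply/matrixP => k l; rewrite !mxE gh.
Qed.

Section Transformation.
Variables (R : realType) (M : manifold R 7) (phi phit : G2_structure M).
Variables T Tt : field M (tensor R 7 2).
Variable V : field M (octonion R).
Hypothesis hT : is_torsion phi T.
Hypothesis hV : unit_section phi V.
Hypothesis hphit : forall i p, dom i p -> G2_form phit i p =1 sigma phi V i p.
Hypothesis hTt : is_torsion phit Tt.
Variables (i : chart M) (p : M).
Hypothesis ip : dom i p.
Variable X : 'rV[R]_7.

Local Notation mul q := (oct_mul (metric phi i q) (G2_form phi i q)).
Local Notation mult q := (oct_mul (metric phit i q) (G2_form phit i q)).
Local Notation Vi q := (inv_section phi V i q).
Local Notation nabla A := (nabla_octonion (metric phi) (fun=> A) i p X).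
Local Notation D A := (nabla A - mul p (A p) (0, torsion_vector (metric phi i p) (T i p) X)).
Local Notation taut := ((0, torsion_vector (metric phit i p) (Tt i p) X) : octonion R).
Local Notation diff A := (exists l, has_dir_oct i p X A l).

Lemma sigma_metricE q : dom i q -> metric phit i q = metric phi i q.
Proof. by move=> iq; apply/funext => I; rewrite (metric_sigma hV hphit). Qed.

Lemma sigma_mulE q A B : dom i q -> mult q A B = mul q (mul q A (mul q B (V i q))) (Vi q).
Proof. by move=> iq; rewrite sigma_metricE // (twisted_mul_sigma hV hphit). Qed.

(** Christoffel symbols involve derivatives of the metric, so its equality is used on all of
    [dom i], not only at [p]. *)
Lemma nabla_phit A : nabla_octonion (metric phit) A i p X = nabla_octonion (metric phi) A i p X.
Proof.
congr pair; apply/rowP => b; rewrite !mxE; apply: eq_bigr => a _; congr (_ * (_ + _)).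
apply: eq_bigr => c _; congr (_ * _); apply: eq_christoffel => // q iq I.
by rewrite sigma_metricE.
Qed.

Lemma nabla_near A B : (forall q, dom i q -> A q = B q) -> diff A -> nabla A = nabla B.
Proof.
move=> AB [l hA]; rewrite (nabla_octonionE _ hA).
by rewrite (nabla_octonionE _ (has_dir_oct_near ip AB hA)) AB.
Qed.

Lemma differentiable_oct_near A B : (forall q, dom i q -> A q = B q) -> diff A -> diff B.
Proof. by move=> AB [l hA]; exists l; apply: has_dir_oct_near hA. Qed.

Lemma differentiable_oct_mul A B : diff A -> diff B -> diff (fun q => mul q (A q) (B q)).
Proof. by move=> [lA hA] [lB hB]; have [] := nabla_mul hT ip hA hB. Qed.

Lemma differentiable_unit_section : diff (V i).
Proof. exact: (octonion_section_has_dir ip X hV.1). Qed.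

Lemma inv_sectionE q : dom i q -> Vi q = oct_conj (V i q).
Proof. by move=> iq; rewrite /inv_section oct_inv_unit // hV.2. Qed.

Lemma has_dir_conj A l : has_dir_oct i p X A l -> has_dir_oct i p X (fun q => oct_conj (A q))
    (oct_conj l).
Proof.
move=> [A1 A2]; split=> // b; rewrite mxE.
by apply: (@has_dir_near _ _ _ _ ip X _ _ _ _ (has_dirN (A2 b))) => q _; rewrite mxE.
Qed.

Lemma differentiable_inv_section : diff (fun q => Vi q).
Proof.
have [l hl] := differentiable_unit_section; apply: (@differentiable_oct_near (fun q => oct_conj
    (V i q))).
  by move=> q iq; rewrite inv_sectionE.
by exists (oct_conj l); apply: has_dir_conj.
Qed.

Lemma G2_mulDl q A B C : dom i q -> mul q (A + B) C = mul q A C + mul q B C.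
Proof. by move=> iq; have [P [PU phiP gP _]] := G2_frame phi iq; apply: oct_mulDl PU gP phiP _
    _ _. Qed.

Lemma G2_mulDr q A B C : dom i q -> mul q A (B + C) = mul q A B + mul q A C.
Proof. by move=> iq; have [P [PU phiP gP _]] := G2_frame phi iq; apply: oct_mulDr PU gP phiP _
    _ _. Qed.

Lemma G2_mulNl q A B : dom i q -> mul q (- A) B = - mul q A B.
Proof. by move=> iq; have [P [PU phiP gP _]] := G2_frame phi iq; apply: oct_mulNl PU gP phiP _
    _. Qed.

Lemma G2_mulNr q A B : dom i q -> mul q A (- B) = - mul q A B.
Proof. by move=> iq; have [P [PU phiP gP _]] := G2_frame phi iq; apply: oct_mulNr PU gP phiP _
    _. Qed.

Lemma mul_unitK q A : dom i q -> mul q (mul q A (V i q)) (Vi q) = A.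
Proof.
move=> iq; have [P [PU phiP gP _]] := G2_frame phi iq.
by rewrite /inv_section (oct_mulK PU gP phiP (hV.2 _ _ iq)).
Qed.

Lemma mul_unitVK q A : dom i q -> mul q (mul q A (Vi q)) (V i q) = A.
Proof.
move=> iq; have [P [PU phiP gP _]] := G2_frame phi iq.
by rewrite /inv_section (oct_mulVK PU gP phiP (hV.2 _ _ iq)).
Qed.

(** [[T, A, B] = [A, B, T] = (A B) T - A (B T)], whose first term is exactly what [D] subtracts from
    the derivative of [A B]. *)
Lemma oct_D_mul A B : diff A -> diff B ->
  D (fun q => mul q (A q) (B q)) = mul p (nabla A) (B p) + mul p (A p) (D B).
Proof.
move=> [lA hA] [lB hB]; have [P [PU phiP gP _]] := G2_frame phi ip.
have [_ ->] := nabla_mul hT ip hA hB.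
rewrite (oct_assocC PU gP phiP) /oct_assoc.
move: (nabla A) (nabla B) => a b; rewrite G2_mulDr // G2_mulNr //.
by rewrite -!addrA; congr (_ + (_ + _)); rewrite addrCA subrr addr0.
Qed.

Lemma oct_D_near A B : (forall q, dom i q -> A q = B q) -> diff A -> D A = D B.
Proof. by move=> AB dA; rewrite (nabla_near AB dA) AB. Qed.

Definition twisted_torsion : octonion R := - mul p (D (V i)) (Vi p).
Local Notation tauh := twisted_torsion.

Lemma mul_twisted_torsion : mul p tauh (V i p) = - D (V i).
Proof. by rewrite /twisted_torsion G2_mulNl // mul_unitVK. Qed.

(** This real part is [- <DV, V>]. The torsion term of [DV] is orthogonal to [V], and the real part
    of the derivative of the constant [V conj V = 1] is [2 <nabla V, V>], associators having no real
    part. *)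
Lemma re_twisted_torsion : tauh.1 = 0.
Proof.
have [P [PU phiP gP _]] := G2_frame phi ip; have V1 := hV.2 _ _ ip.
rewrite /twisted_torsion inv_sectionE // -[LHS]/(- (mul p (D (V i)) (oct_conj (V i p))).1).
rewrite G2_mulDl // G2_mulNl // -[(_ - _).1]/(_.1 - _.1) !(re_oct_mul_conj PU gP phiP).
rewrite (oct_inner_mulr PU gP phiP) // subr0.
have [l hl] := differentiable_unit_section; have [_] := nabla_mul hT ip hl (has_dir_conj hl).
have h1 : has_dir_oct i p X (fun=> (1, 0)) 0.
  by split=> [|b]; rewrite ?mxE; apply: has_dir_cst.
rewrite -(@nabla_near (fun=> (1, 0))); last by exists 0.
  rewrite (nabla_octonionE _ h1) mul0mx addr0 => /(congr1 fst).
  rewrite (nabla_octonionE _ (has_dir_conj hl)) (nabla_octonionE _ hl).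
  set W := l + (0, _); have -> : oct_conj l + (0, (oct_conj (V i p)).2 *m connection_mx i p X
      (metric phi)) = oct_conj W.
    by rewrite /W /oct_conj /= mulNmx opprD.
  rewrite -[(_ + _ + _).1]/(_.1 + _.1 + _.1) (re_oct_assoc PU gP phiP) !(re_oct_mul_conj PU gP
      phiP).
  rewrite (oct_innerC gP (V i p)) addr0 => /esym; lra.
move=> q iq; have [Q [QU phiQ gQ _]] := G2_frame phi iq.
by rewrite -inv_sectionE // -{1}[V i q](oct_mul1 QU gQ phiQ) mul_unitK.
Qed.

Lemma nabla_sigma_mul A B : diff A -> diff B ->
  nabla (fun q => mult q (A q) (B q)) =
  mult p (nabla A) (B p) + mult p (A p) (nabla B)
  + oct_assoc (metric phit i p) (G2_form phit i p) (A p) (B p) tauh.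
Proof.
move=> dA dB; pose C q := mult q (A q) (B q).
have dBV := differentiable_oct_mul dB differentiable_unit_section; have dC : diff C.
  apply: (@differentiable_oct_near (fun q => mul q (mul q (A q) (mul q (B q) (V i q))) (Vi q))).
    by move=> q iq; rewrite /C sigma_mulE.
  apply: differentiable_oct_mul differentiable_inv_section; exact: differentiable_oct_mul.
have CV q : dom i q -> mul q (C q) (V i q) = mul q (A q) (mul q (B q) (V i q)).
  by move=> iq; rewrite /C sigma_mulE // mul_unitVK.
have := oct_D_near CV (differentiable_oct_mul dC differentiable_unit_section).
rewrite (oct_D_mul dC differentiable_unit_section) (oct_D_mul dA dBV) (oct_D_mul dB
    differentiable_unit_section) -!/(C p) => E.
have {}E : nabla C = mul p (mul p (nabla A) (mul p (B p) (V i p))) (Vi p)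
   + mul p (mul p (A p) (mul p (nabla B) (V i p))) (Vi p)
   + (mul p (mul p (A p) (mul p (B p) (D (V i)))) (Vi p) - mul p (mul p (C p) (D (V i))) (Vi
       p)).
  rewrite -[LHS](mul_unitK _ ip) -[X in mul p X _ = _](addrK (mul p (C p) (D (V i)))) E.
  move: (mul p (nabla A) _) (mul p (nabla B) _) (mul p (B p) (D _)) (mul p (C p) _) => a b c d.
  by rewrite G2_mulDl // G2_mulNl // G2_mulDl // (G2_mulDr (A p) b c ip) G2_mulDl // !addrA.
rewrite E -!sigma_mulE //; congr (_ + _).
(* With this form of [DV], and [o] for the twisted product, the two remaining terms are
   [(A o B) o tauh] and [- A o (B o tauh)]. *)
have DV : D (V i) = - mul p tauh (V i p) by rewrite mul_twisted_torsion opprK.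
set t := mul p tauh (V i p) in DV *.
rewrite DV (G2_mulNr (B p) t ip) (G2_mulNr (A p) _ ip) (G2_mulNl _ (Vi p) ip).
rewrite (G2_mulNr (C p) t ip) (G2_mulNl _ (Vi p) ip) opprK addrC /oct_assoc; congr (_ - _).
  by rewrite [RHS]sigma_mulE.
by rewrite (sigma_mulE (A p) _ ip) (sigma_mulE (B p) _ ip) (mul_unitVK _ ip).
Qed.

(** The product of [phit] obeys one Leibniz rule with [taut] and one with [tauh]. On the same pair
    the terms in [nabla] cancel, leaving [[x, y, tauh] = [taut, x, y] = [x, y, taut]]. *)
Lemma sigma_torsionE : taut = tauh.
Proof.
have [Q [QU phiQ gQ _]] := G2_frame phit ip.
suff E : tauh - taut = 0 by apply/esym/eqP; rewrite -subr_eq0 E.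
apply: (oct_assoc_nondegenerate QU gQ phiQ) => [|x y].
  by rewrite -[(_ - _).1]/(_.1 - _.1) re_twisted_torsion subr0.
(* Constant components in chart [i] realize every imaginary value at [p]. *)
have hc x' : has_dir_oct i p X (fun=> (0, x')) 0.
  by split=> [|b]; rewrite ?mxE; apply: has_dir_cst.
have [_] := nabla_mul hTt ip (hc x) (hc y).
rewrite !nabla_phit nabla_sigma_mul; [|by exists 0..].
by move/addrI => E; rewrite (oct_assocBr QU gQ phiQ) E (oct_assocC QU gQ phiQ) subrr.
Qed.

Lemma oct_D_sigma A : diff A ->
  nabla_octonion (metric phit) (fun=> A) i p X - mult p (A p) taut =
  mul p (D (fun q => mul q (A q) (V i q))) (Vi p).
Proof.
move=> dA; rewrite nabla_phit sigma_torsionE sigma_mulE // mul_twisted_torsion (oct_D_mul dA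
    differentiable_unit_section).
by rewrite !(G2_mulNr, G2_mulNl) // opprK G2_mulDl // mul_unitK.
Qed.

End Transformation.

Theorem proposition7p8 (R : realType) (M : manifold R 7)
    (phi phit : G2_structure M)
    (T Tt : field M (tensor R 7 2))
    (V : field M (octonion R))
    (hT : is_torsion phi T)
    (hV : unit_section phi V)
    (hphit : forall i p, dom i p -> G2_form phit i p =1 sigma phi V i p)
    (hTt : is_torsion phit Tt) :
  (forall A : field M (octonion R), octonion_section A ->
     forall (i : chart M) (p : M), dom i p -> forall X : 'rV[R]_7,
       oct_D phit Tt (mul_section phi A (inv_section phi V)) i p X =
       oct_mul (metric phi i p) (G2_form phi i p)
         (oct_D phi T A i p X) (inv_section phi V i p)) /\
  (forall A : field M (octonion R), octonion_section A ->
     forall (i : chart M) (p : M), dom i p -> forall X : 'rV[R]_7,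
       oct_D phit Tt A i p X =
       oct_mul (metric phi i p) (G2_form phi i p)
         (oct_D phi T (mul_section phi A V) i p X) (inv_section phi V i p)).
Proof.
split=> A hA i p ip X; have dA := octonion_section_has_dir ip X hA; last first.
  exact: (oct_D_sigma hT hV hphit hTt ip dA).
(* The first identity is the second one at [A V^-1], since [(A V^-1) V = A]. *)
have dAV := differentiable_oct_mul hT ip dA (differentiable_inv_section hV ip X).
rewrite [LHS](oct_D_sigma hT hV hphit hTt ip dAV); congr (oct_mul _ _ _ _).
apply: oct_D_near => // [q iq|]; last exact: (differentiable_oct_mul hT ip dAV
    (differentiable_unit_section hV ip X)).
by rewrite (mul_unitVK hV).
Qed.
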